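(* Let $\mathcal A=\mathbb K[x_1,\dots,x_n]$ be a quasi-regular Poisson algebra of index $l$ and let $\{Q_1,\dots,Q_l\}\subset Z(\mathcal A)$ be an admissible set. Then $\pi^{(n-l)/2}=\lambda\, j_{dQ_1\wedge\dots\wedge dQ_l}(\partial_1\wedge\dots\wedge\partial_n)$ for some nonzero $\lambda\in\mathbb K$.
   Context: $\mathbb K$ is algebraically closed of characteristic $0$. Let $W$ be the free $\mathcal A$-module of derivations of $\mathcal A$, with basis $\partial_i=\partial/\partial x_i$, let $\Omega^1=\mathrm{Hom}_{\mathcal A}(W,\mathcal A)$ and $\Omega=\bigoplus_k\Omega^k$ its exterior algebra, with $d$ the exterior differential. $\Omega^k$ and $\bigwedge^k_{\mathcal A}W$ are paired by $\langle\alpha_1\wedge\dots\wedge\alpha_k,D_1\wedge\dots\wedge D_k\rangle=\det(\alpha_i(D_j))$. For $\omega\in\Omega^p$, $j_\omega$ is the $\mathcal A$-linear endomorphism of $\bigwedge_{\mathcal A}W$ of degree $-p$ with $\langle\eta,j_\omega(D)\rangle=\langle\eta\wedge\omega,D\rangle$ for all $\eta\in\Omega$, $D\in\bigwedge_{\mathcal A}W$. A Poisson bracket on $\mathcal A$ is encoded by its bivector $\pi\in\bigwedge^2_{\mathcal A}W$ with $\langle df\wedge dg,\pi\rangle=\{f,g\}$; $\pi^k$ is the $k$-fold wedge power. $\mathrm{rk}\,\pi(\xi)$ is the rank of the matrix $(\{x_i,x_j\})$ at $\xi\in\mathbb A^n$; the index is ${\rm ind}\,\mathcal A=n-\max_\xi\mathrm{rk}\,\pi(\xi)$;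 $\mathrm{Sing}\,\pi=\{\xi:\mathrm{rk}\,\pi(\xi)<n-{\rm ind}\,\mathcal A\}$; $Z(\mathcal A)$ is the Poisson centre. The Jacobian locus $\mathcal J(g_1,\dots,g_m)$ is the set of $\xi$ where $d_\xi g_1,\dots,d_\xi g_m$ are linearly dependent. A subset $\{Q_1,\dots,Q_l\}\subset Z(\mathcal A)$ is admissible if $l={\rm ind}\,\mathcal A$ and $\mathcal J(Q_1,\dots,Q_l)$ has codimension $\ge2$ in $\mathbb A^n$. $\mathcal A$ is quasi-regular if $Z(\mathcal A)$ contains an admissible subset and $\mathrm{Sing}\,\pi$ has codimension $\ge 2$ in $\mathbb A^n$. *)

(* Defs.v *)
From HB Require Import structures.
From mathcomp Require Import all_boot all_order all_algebra.
From mathcomp Require Import mpoly.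
Set Implicit Arguments. Unset Strict Implicit. Unset Printing Implicit Defensive.
Import Order.TTheory GRing.Theory Num.Theory.
Local Open Scope ring_scope.

Section PoissonDefs.
Variables (K : fieldType) (n : nat).
Notation A := {mpoly K[n]}.
Notation pt := ('I_n -> K).

Definition is_poisson_bracket (br : A -> A -> A) : Prop :=
  [/\ (forall (c : K) f g h, br (c *: f + g) h = c *: br f h + br g h),
      (forall f g, br f g = - br g f),
      (forall f g h, br f (g * h) = br f g * h + g * br f h)
    & (forall f g h, br f (br g h) + br g (br h f) + br h (br f g) = 0)].

Definition in_poisson_centre (br : A -> A -> A) (f : A) : Prop :=
  forall g, br f g = 0.

Definition pimx (br : A -> A -> A) (xi : pt) : 'M[K]_n :=
  \matrix_(i < n, j < n) (br 'X_i 'X_j).@[xi].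
Definition rk_pi br (xi : pt) : nat := \rank (pimx br xi).

Definition is_index (br : A -> A -> A) (l : nat) : Prop :=
  (l <= n)%N /\ (exists xi, rk_pi br xi = (n - l)%N)
  /\ (forall xi, (rk_pi br xi <= n - l)%N).

Definition Sing_pi br (l : nat) (xi : pt) : Prop := (rk_pi br xi < n - l)%N.

Definition jacobian_locus m (g : 'I_m -> A) (xi : pt) : Prop :=
  ~~ row_free (\matrix_(k < m, i < n) (mderiv i (g k)).@[xi]).

Definition zclosed (S : pt -> Prop) : Prop :=
  exists F : A -> Prop, forall xi, S xi <-> (forall p, F p -> p.@[xi] = 0).
Definition subs (S T : pt -> Prop) := forall xi, S xi -> T xi.
Definition irreducible_closed (S : pt -> Prop) : Prop :=
  [/\ zclosed S, exists xi, S xi &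
      forall Z1 Z2, zclosed Z1 -> zclosed Z2 ->
        subs S (fun xi => Z1 xi \/ Z2 xi) -> subs S Z1 \/ subs S Z2].
(* (Krull) dimension of S is <= d : every strictly increasing chain
   Z_0 < Z_1 < ... < Z_k of irreducible closed subsets contained in S has k <= d.
   codim S >= 2 in A^n  :<=>  dim S <= n - 2  (i.e. k + 2 <= n). *)
Definition codim_ge2 (S : pt -> Prop) : Prop :=
  forall (k : nat) (Z : nat -> pt -> Prop),
    (forall i, (i <= k)%N -> irreducible_closed (Z i) /\ subs (Z i) S) ->
    (forall i, (i < k)%N -> subs (Z i) (Z i.+1) /\ ~ subs (Z i.+1) (Z i)) ->
    (k + 2 <= n)%N.

Definition admissible br (l : nat) (Q : 'I_l -> A) : Prop :=
  [/\ (forall k, in_poisson_centre br (Q k)), is_index br l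
    & codim_ge2 (jacobian_locus Q)].

Definition quasi_regular br : Prop :=
  exists l, is_index br l /\ (exists Q : 'I_l -> A, admissible br Q)
            /\ codim_ge2 (Sing_pi br l).

(* Both /\_A W (basis d_I = d_{i1}/\../\d_{ik}, i1<..<ik, I = {i1..ik}) and
   Omega (basis dx_I) are free A-modules with basis indexed by subsets of
   'I_n; an element is its coordinate function. *)
Definition ext := {ffun {set 'I_n} -> A}.

Definition ext_scale (c : A) (a : ext) : ext := [ffun I => c * a I].
Definition ext_one : ext := [ffun I => (I == set0)%:R].
Definition ext_basis (I : {set 'I_n}) : ext := [ffun J => (J == I)%:R].

(* sign of e_I /\ e_J = (-1)^{#inversions} e_{I u J} for disjoint I, J *)
Definition wsign (I J : {set 'I_n}) : nat :=
  #|[set p : 'I_n * 'I_n | (p.1 \in I) && (p.2 \in J) && (p.2 < p.1)%N]|.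

Definition wedge (a b : ext) : ext :=
  [ffun L => \sum_(I : {set 'I_n}) \sum_(J : {set 'I_n} |
               [disjoint I & J] && (I :|: J == L))
               (-1) ^+ wsign I J * a I * b J].

Definition wpow (a : ext) (k : nat) : ext := iter k (wedge a) ext_one.

(* pairing <eta, D> (Omega^k against /\^k W, zero between different degrees) *)
Definition pairing (eta D : ext) : A := \sum_(I : {set 'I_n}) eta I * D I.

(* j_omega: the A-linear map with <eta, j_omega D> = <eta /\ omega, D> for all
   eta; its I-th coordinate is <dx_I /\ omega, D>. *)
Definition jmap (omega D : ext) : ext :=
  [ffun I => pairing (wedge (ext_basis I) omega) D].

Definition bivector (br : A -> A -> A) : ext :=
  \sum_(i < n) \sum_(j < n | (i < j)%N)
     ext_scale (br 'X_i 'X_j) (wedge (ext_basis [set i]) (ext_basis [set j])).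

Definition dform (Q : A) : ext :=
  \sum_(i < n) ext_scale (mderiv i Q) (ext_basis [set i]).

Definition volvec : ext := ext_basis setT.

End PoissonDefs.

(* Main.v *)
Require Import Defs.
From HB Require Import structures.
From mathcomp Require Import all_boot all_order all_algebra.
From mathcomp Require Import mpoly ring zify.
From Stdlib Require Import Classical_Prop Classical_Pred_Type FunctionalExtensionality.
Set Implicit Arguments. Unset Strict Implicit. Unset Printing Implicit Defensive.
Import Order.TTheory GRing.Theory Num.Theory.
Local Open Scope ring_scope.

(** Write [P = pi^((n-l)/2)] and [R = j_{dQ_1 /\ ... /\ dQ_l}(volume)]. At a point
    where the [dQ_k] are independent, contraction with each [dQ_k] kills [P], because
    the [Q_k] are central; recovering [P] from its product with dual vectors, which has
    top degree, shows that [P] is a multiple of [R] there. Hence [P_I R_J = P_J R_I]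
    for all coordinates. As polynomial rings are factorial, a common denominator can be
    cleared prime by prime: a prime dividing every [R_J] (resp. every [P_J]) would put an
    irreducible hypersurface inside the Jacobian locus (resp. inside [Sing pi]), which
    both have codimension at least 2. So [P = lambda R] with [lambda] a unit. *)

(** * Factoriality of polynomial rings *)

(** Codimension is defined through chains of irreducible closed sets, so contradicting it means
    exhibiting a chain of full length below a hypersurface [q = 0]. Its top member is irreducible by
    a Nullstellensatz for prime [q]; the lower members come from cutting with hyperplanes.
    Proportionality at points becomes a polynomial identity because independence of the [dQ_k] at
    one point spreads to a nonempty open set, described by a single determinant. Placing a prime
    divisor of all [P_J] inside [Sing pi] requires that a bivector of rank [2k] have nonzero [k]-th
    power. This is proved by splitting off hyperbolic planes, and characteristic 0 enters there
    through factors [2] and [k + 1]. The signs of the exterior algebra are confined to a few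
    operators obeying anticommutation relations over any commutative ring, so the same identities
    serve polynomial multivectors and their values at a point. *)

Lemma exists_least_counterexample (P : nat -> Prop) :
  (exists i, ~ P i) -> exists2 i, ~ P i & forall j, (j < i)%N -> P j.
Proof.
case=> i; elim/ltn_ind: i => i IH nPi.
have [[j [ji nPj]]|none] := classic (exists j, (j < i)%N /\ ~ P j).
  exact: IH ji nPj.
by exists i => // j ji; apply: NNPP => nPj; apply: none; exists j.
Qed.

Section Factoriality.
Variable R : idomainType.
Implicit Types (a b c p q u : R) (s : seq R).

Definition divides a b := exists c, b = c * a.

Definition prime_elt p :=
  [/\ p != 0, p \isn't a GRing.unit &
      forall a b, divides p (a * b) -> divides p a \/ divides p b].

Definition factorization x (us : R * seq R) :=
  [/\ us.1 \is a GRing.unit, {in us.2, forall p, prime_elt p} &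
      x = us.1 * \prod_(p <- us.2) p].

Lemma dividesD p a b : divides p a -> divides p b -> divides p (a + b).
Proof. by case=> c -> [d ->]; exists (c + d); rewrite mulrDl. Qed.

Lemma dividesN p a : divides p a -> divides p (- a).
Proof. by case=> c ->; exists (- c); rewrite mulNr. Qed.

Lemma dividesMl p a b : divides p b -> divides p (a * b).
Proof. by case=> c ->; exists (a * c); rewrite mulrA. Qed.

Lemma dividesMr p a b : divides p a -> divides p (a * b).
Proof. by rewrite mulrC; exact: dividesMl. Qed.

Lemma divides0 p : divides p 0.
Proof. by exists 0; rewrite mul0r. Qed.

Lemma dividesxx p : divides p p.
Proof. by exists 1; rewrite mul1r. Qed.

Lemma divides_sum p (I : Type) (r : seq I) (P : pred I) (F : I -> R) :
  (forall i, P i -> divides p (F i)) -> divides p (\sum_(i <- r | P i) F i).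
Proof.
by move=> pF; apply: big_ind => //; [exact: divides0 | exact: dividesD].
Qed.

Lemma prime_ndivides_unit p u : prime_elt p -> u \is a GRing.unit -> ~ divides p u.
Proof.
by case=> _ nUp _ Uu [c uE]; move: Uu; rewrite uE unitrM (negbTE nUp) andbF.
Qed.

(** A prime is irreducible, so a nonunit divisor of it is an associate of it. *)
Lemma divides_nonunit_prime p q :
  q \isn't a GRing.unit -> prime_elt p -> divides q p -> divides p q.
Proof.
move=> nUq [p0 nUp pP] [c pE].
have [[d cE]|//] : divides p c \/ divides p q by apply: pP; rewrite -pE; exact: dividesxx.
case/negP: nUq; apply/unitrP; exists d.
have /(mulfI p0) dq1 : p * (d * q) = p * 1 by rewrite mulr1 {2}pE cE; ring.
by rewrite [q * d]mulrC.
Qed.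

(** The prime [p] divides one of the listed primes, hence is associated to it, and the unit between
    them joins the leading unit. The exact drop in length drives the induction on leading
    coefficients in [factorial_poly]. *)
Lemma factorization_divide x us p : factorization x us -> prime_elt p -> divides p x ->
  exists2 vt, size us.2 = (size vt.2).+1 & exists2 y, factorization y vt & x = p * y.
Proof.
case: us => u s [/= Uu sP ->] pp; elim: s sP => [|q s IH] sP.
  by rewrite big_nil mulr1 => /(prime_ndivides_unit pp Uu).
have qP : prime_elt q by apply: sP; rewrite mem_head.
have {}IH := IH (fun r rs => sP r (mem_behead (s := q :: s) rs)).
rewrite big_cons mulrCA => pd.
have [_ _ /(_ _ _ pd)] := pp; case=> [pq|/IH[[v t] /= -> [y [/= Uv tP ->] ->]]]; last first.
  exists (v, q :: t) => //; exists (v * \prod_(r <- q :: t) r).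
    by split=> //= r; rewrite inE => /predU1P[->//|/tP].
  by rewrite big_cons; move: (\prod_(r <- t) r) => z; rewrite mulrCA (mulrCA v).
have [d pE] : divides q p by apply: divides_nonunit_prime qP pq; case: pp.
have [c qE] := pq.
have [q0 _ _] := qP.
have /(mulfI q0) cd1 : q * (c * d) = q * 1.
  by rewrite mulr1 {2}qE pE; ring.
have Uc : c \is a GRing.unit by apply/unitrP; exists d; rewrite [d * c]mulrC cd1.
exists (u * c, s) => //; exists (u * c * \prod_(r <- s) r).
  by split=> //=; [rewrite unitrM Uu | move=> r rs; apply: sP; rewrite inE rs orbT].
by rewrite qE; move: (\prod_(r <- s) r) => z; ring.
Qed.

Lemma factorizationM x y us vt : factorization x us -> factorization y vt ->
  factorization (x * y) (us.1 * vt.1, us.2 ++ vt.2).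
Proof.
case=> Uu sP -> [Uv tP ->]; split=> /=; first by rewrite unitrM Uu.
  by move=> p; rewrite mem_cat => /orP[/sP|/tP].
by rewrite big_cat /= mulrACA.
Qed.

Lemma factorization_prime p : prime_elt p -> factorization p (1, [:: p]).
Proof.
by split=> /=; [exact: unitr1 | move=> q; rewrite inE => /eqP-> | rewrite big_seq1 mul1r].
Qed.

(** Since the factors are prime and not merely irreducible, existence alone characterises unique
    factorization. *)
Definition factorial_ring := forall x : R, x != 0 -> exists us, factorization x us.

Lemma factorial_prime_divisor x : factorial_ring -> x != 0 -> x \isn't a GRing.unit ->
  exists2 p, prime_elt p & divides p x.
Proof.
move=> fR /fR[[u [|p s]] [/= Uu sP ->]]; first by rewrite big_nil mulr1 Uu.
move=> _; exists p; first by apply: sP; rewrite mem_head.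
by rewrite big_cons mulrCA; apply: dividesMr; exact: dividesxx.
Qed.

End Factoriality.

(** * Gauss's lemma and unique factorization for polynomials in one variable *)

Section GaussLemma.
Variable R : idomainType.
Implicit Types (p : R) (f g h : {poly R}).

Lemma divides_polyC p f : divides p%:P f <-> forall i, divides p f`_i.
Proof.
split=> [[g ->] i|pf]; first by exists g`_i; rewrite coefMC.
suff [g fE] : exists g : {poly R}, \poly_(i < size f) f`_i = g * p%:P.
  by exists g; rewrite -fE coefK.
elim: (size f) => [|m [g IH]]; first by exists 0; rewrite mul0r poly_def big_ord0.
have [c cE] := pf m; exists (g + c *: 'X^m).
rewrite mulrDl -IH !poly_def big_ord_recr /= cE mulrC -[c *: _]mul_polyC.
by rewrite mulrAC -polyCM mul_polyC [p * c]mulrC.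
Qed.

Lemma prime_polyC p : prime_elt p -> prime_elt p%:P.
Proof.
case=> p0 nUp pP; split; first by rewrite polyC_eq0.
  by apply: contra nUp; rewrite poly_unitE coefC eqxx => /andP[].
move=> f g /divides_polyC pfg; apply: NNPP => /not_or_and[nf ng].
have ex h : ~ divides p%:P h -> exists i, ~ divides p h`_i.
  by move=> nh; apply: not_all_ex_not => pA; apply/nh/divides_polyC.
have [i npi ltpi] := exists_least_counterexample (ex _ nf).
have [j npj ltpj] := exists_least_counterexample (ex _ ng).
suff /pP[] : divides p (f`_i * g`_j) by [].
(* In the coefficient of degree [i + j], every summand other than this one contains a coefficient of
   [f] before [i] or of [g] before [j], hence is divisible by [p]. *)
have -> : f`_i * g`_j = (f * g)`_(i + j) -
    \sum_(k < (i + j).+1 | k != inord i) f`_k * g`_(i + j - k).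
  rewrite coefM (bigD1 (inord i)) //= inordK ?ltnS ?leq_addr // addKn.
  by rewrite addrK.
apply: dividesD (pfg _) _; apply/dividesN/divides_sum => k.
rewrite -val_eqE /= inordK ?ltnS ?leq_addr // neq_ltn => /orP[/ltpi pk|ik].
  exact: dividesMr.
apply/dividesMl/ltpj; rewrite ltn_subLR ?ltn_add2r //.
by rewrite -ltnS.
Qed.

Lemma prime_of_polyC p : prime_elt p%:P -> prime_elt p.
Proof.
case=> p0 nUp pP; split; first by rewrite -polyC_eq0.
  by apply: contra nUp => Up; rewrite poly_unitE coefC eqxx size_polyC -polyC_eq0 p0.
have dvP a : divides p%:P a%:P <-> divides p a.
  split=> [/divides_polyC/(_ 0%N)|[c ->]]; first by rewrite coefC.
  by exists c%:P; rewrite polyCM.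
by move=> a b /dvP; rewrite polyCM => /pP[]/dvP; [left|right].
Qed.

Hypothesis fR : factorial_ring R.

Definition primitive f := forall p, prime_elt p -> ~ divides p%:P f.

(** Each prime of [c] divides the cofactor times [f], hence the cofactor, and cancels. Divisibility
    over the fraction field thus descends to [R]. *)
Lemma primitive_divides f g (c : R) : primitive f -> c != 0 ->
  divides f (c *: g) -> divides f g.
Proof.
move=> fprim /fR[[u s] [/= Uu sP ->]]; elim: s sP => [|p s IH] sP.
  rewrite big_nil mulr1 => -[h hE]; exists (u^-1 *: h).
  by rewrite -scalerAl -hE scalerA mulVr // scale1r.
have pp : prime_elt p by apply: sP; rewrite mem_head.
rewrite big_cons mulrCA -scalerA => -[h hE].
apply: IH => [r rs|]; first by apply: sP; rewrite inE rs orbT.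
have [p0 _ pP] := prime_polyC pp.
have [[k kE]|/fprim] : divides p%:P h \/ divides p%:P f; last by case.
  by apply: pP; exists ((u * \prod_(r <- s) r) *: g); rewrite -hE -mul_polyC mulrC.
exists k; apply: (mulfI p0); rewrite mul_polyC hE kE; ring.
Qed.

(* Multiplying by [c] stands for a factorization over the fraction field of [R]. *)
Lemma clear_denominator (c : R) f g h : c != 0 -> c *: f = g * h ->
  exists g' h', [/\ f = g' * h', size g' = size g & size h' = size h].
Proof.
move=> /fR[[u s] [/= Uu sP ->]]; elim: s sP g h => [|p s IH] sP g h.
  rewrite big_nil mulr1 => fE; exists (u^-1 *: g), h; split=> //.
    by rewrite -scalerAl -fE scalerA mulVr // scale1r.
  rewrite size_scale //; apply: contraTneq Uu => /eqP.
  by rewrite invr_eq0 => /eqP ->; rewrite unitr0.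
have pp : prime_elt p by apply: sP; rewrite mem_head.
have {}IH := IH (fun r rs => sP r (mem_behead (s := p :: s) rs)).
rewrite big_cons mulrCA -scalerA => fE.
have [p0 _ pP] := prime_polyC pp; have pnz : p != 0 by case: pp.
have [[k kE]|[k kE]] : divides p%:P g \/ divides p%:P h.
- by apply: pP; exists ((u * \prod_(r <- s) r) *: f); rewrite -fE -mul_polyC mulrC.
- have [|g' [h' [-> sg sh]]] := IH k h.
    by apply: (mulfI p0); rewrite mul_polyC fE kE; ring.
  by exists g', h'; split=> //; rewrite kE mulrC mul_polyC size_scale.
- have [|g' [h' [-> sg sh]]] := IH g k.
    by apply: (mulfI p0); rewrite mul_polyC fE kE; ring.
  by exists g', h'; split=> //; rewrite kE mulrC mul_polyC size_scale.
Qed.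

(** Only factors of positive degree count; constant factors are controlled separately, by
    primitivity. *)
Definition splits f := exists g h, [/\ f = g * h, (1 < size g)%N & (1 < size h)%N].

(** Over the fraction field [f] is irreducible, so its gcd with [g] is constant or of the degree of
    [f]. The first case yields [f] dividing [h] by Bezout, the second [f] dividing [g], each up to a
    constant removed by [primitive_divides]. *)
Lemma primitive_unsplit_prime f : (1 < size f)%N -> primitive f -> ~ splits f ->
  prime_elt f.
Proof.
move=> sf fprim nsplit; have f0 : f != 0 by rewrite -size_poly_gt0 ltnW.
split=> //; first by rewrite poly_unitE gtn_eqF.
move=> g h fgh; apply: NNPP => /not_or_and[nfg nfh].
have /Pdiv.Idomain.dvdpP[[c d] /= c0 fE] := dvdp_gcdl f g.
have /Pdiv.Idomain.dvdpP[[c' d'] /= c'0 gE] := dvdp_gcdr f g.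
(* An honest factorization of [f] with the sizes of [d] and of the gcd: since [f] does not split,
   one of the two is constant. *)
have [d1 [e1 [fE' sd se]]] := clear_denominator c0 fE.
have [le1|gt1] := leqP (size (gcdp f g)) 1.
  apply: nfh; have gcd1 : size (gcdp f g) = 1%N.
    by apply/eqP; rewrite eqn_leq le1 size_poly_gt0 gcdp_eq0 (negbTE f0).
  have [[a b] /= /eqpP[[k1 k2] /= /andP[k10 k20] bez]] := Bezoutp f g.
  have [k kE] : exists k, gcdp f g = k%:P by exists (gcdp f g)`_0; apply: size1_polyC.
  have k0 : k2 * k != 0.
    by rewrite mulf_neq0 // -polyC_eq0 -kE -size_poly_gt0 gcd1.
  apply: (primitive_divides (c := k2 * k)) fprim k0 _.
  have -> : (k2 * k) *: h = k1 *: (a * h) * f + k1 *: b * (g * h).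
    have -> : (k2 * k) *: h = (k2 *: gcdp f g) * h by rewrite kE -!mul_polyC polyCM.
    by rewrite -bez -!mul_polyC; ring.
  by apply: dividesD; [apply/dividesMl/dividesxx | apply: dividesMl].
have [gt1'|le1'] := ltnP 1 (size d).
  by apply: nsplit; exists d1, e1; rewrite sd se.
have [k kE] : exists k, d = k%:P by exists d`_0; apply: size1_polyC.
have k0 : k != 0.
  apply: contraTneq f0 => k0; rewrite negbK -size_poly_eq0 -(size_scale _ c0) fE kE k0.
  by rewrite mul0r size_poly0.
apply: nfg; apply: (primitive_divides (c := k * c')) fprim _ _; first exact: mulf_neq0.
exists (c *: d'); have -> : (k * c') *: g = d' * (d * gcdp f g).
  by rewrite -scalerA gE kE -mul_polyC; ring.
by rewrite -fE -!mul_polyC; ring.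
Qed.

Lemma factorization_polyC (x : R) us : factorization x us ->
  factorization x%:P (us.1%:P, map polyC us.2).
Proof.
case=> Uu sP xE; split=> /=.
- have u0 : us.1 != 0 by apply: contraTneq Uu => ->; rewrite unitr0.
  by rewrite poly_unitE coefC eqxx size_polyC u0 Uu.
- by move=> p /mapP[q /sP/prime_polyC ? ->].
- by rewrite xE polyCM rmorph_prod big_map.
Qed.

(** Outer induction on the degree handles polynomials that split; an unsplit one loses its constant
    prime factors one at a time until it is primitive, hence prime. *)
Lemma factorial_poly : factorial_ring {poly R}.
Proof.
move=> f; move: {2}(size f) (leqnn (size f)) => m; elim: m f => [|m IH] f.
  by rewrite leqn0 size_poly_eq0 => ->.
move=> sfm f0; have [le1|gt1] := leqP (size f) 1.
  have fE := size1_polyC le1; have : f`_0 != 0 by rewrite -polyC_eq0 -fE.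
  by move/fR=> [us /factorization_polyC]; rewrite -fE => ?; eexists; eassumption.
have [[g [h [fE sg sh]]]|nsplit] := classic (splits f).
  have g0 : g != 0 by rewrite -size_poly_gt0 ltnW.
  have h0 : h != 0 by rewrite -size_poly_gt0 ltnW.
  have szE : (size f).+1 = (size g + size h)%N.
    rewrite fE size_mul // prednK // addn_gt0 ltnW //.
  have [|us us_g] := IH g _ g0.
    by lia.
  have [|vt vt_h] := IH h _ h0.
    by lia.
  by rewrite fE; eexists; apply: factorizationM us_g vt_h.
have [us us_f] : exists us, factorization (lead_coef f) us.
  by apply: fR; rewrite lead_coef_eq0.
(* The inner induction counts the primes of the leading coefficient: removing a constant prime
   factor lowers it by one, and at zero the leading coefficient is a unit, so [f] is primitive. *)
elim: {us}(size us.2) {-2}us (erefl (size us.2)) f f0 gt1 nsplit us_f {IH sfm}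
  => [|k IHk] us szus f f0 gt1 nsplit us_f.
  exists (1, [:: f]); apply: factorization_prime.
  apply: primitive_unsplit_prime => // p pp [g fE].
  case: us szus us_f => u [|//] _ [/= Uu _ lE].
  apply: (prime_ndivides_unit pp Uu); exists (lead_coef g).
  by move: lE; rewrite big_nil mulr1 fE lead_coefM lead_coefC.
have [[p [pp [g fE]]]|fprim] := classic (exists p, prime_elt p /\ divides p%:P f);
  last first.
  exists (1, [:: f]); apply: factorization_prime.
  by apply: primitive_unsplit_prime => // p pp pf; apply: fprim; exists p.
have lE : lead_coef f = lead_coef g * p by rewrite fE lead_coefM lead_coefC.
have [vt szvt [y vt_y yE]] := factorization_divide us_f pp (ex_intro _ _ lE).
have p0 : p != 0 by case: pp.
have {yE} yE : y = lead_coef g by apply: (mulfI p0); rewrite -yE lE mulrC.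
have sgf : size g = size f by rewrite fE mulrC mul_polyC size_scale.
have g0 : g != 0 by rewrite -size_poly_eq0 sgf size_poly_eq0.
rewrite yE in vt_y; have [|||w w_g] := IHk vt _ g g0 _ _ vt_y.
- by apply: succn_inj; rewrite -szvt.
- by rewrite sgf.
- case=> g1 [g2 [gE s1 s2]]; apply: nsplit; exists (p *: g1), g2.
  by rewrite size_scale // fE gE mulrC mul_polyC scalerAl.
have w_p := factorization_prime (prime_polyC pp).
by exists (w.1 * 1, w.2 ++ [:: p%:P]); rewrite fE; apply: factorizationM w_g w_p.
Qed.

End GaussLemma.

(** * Splitting off the last variable *)

Section FactorialTransfer.
Variables (R S : idomainType) (phi : {rmorphism R -> S}) (psi : {rmorphism S -> R}).
Hypotheses (phiK : cancel phi psi) (psiK : cancel psi phi).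

Lemma iso_divides a b : divides (phi a) (phi b) <-> divides a b.
Proof.
split=> [[c E]|[c ->]]; last by exists (phi c); rewrite rmorphM.
by exists (psi c); apply: (can_inj phiK); rewrite rmorphM psiK.
Qed.

Lemma iso_unit a : (phi a \is a GRing.unit) = (a \is a GRing.unit).
Proof.
by apply/idP/idP => [/(rmorph_unit psi)|/(rmorph_unit phi)//]; rewrite phiK.
Qed.

Lemma iso_prime a : prime_elt (phi a) <-> prime_elt a.
Proof.
have nz : (phi a != 0) = (a != 0) by rewrite -(inj_eq (can_inj phiK)) rmorph0.
rewrite /prime_elt nz iso_unit; split=> -[a0 nUa aP]; split=> // x y.
  by move=> /iso_divides; rewrite rmorphM => /aP[]/iso_divides; [left|right].
rewrite -(psiK x) -(psiK y) -rmorphM.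
by move=> /iso_divides/aP[]/iso_divides; [left|right].
Qed.

Lemma iso_factorial : factorial_ring S -> factorial_ring R.
Proof.
move=> fS x x0; have : phi x != 0 by rewrite -(inj_eq (can_inj phiK)) rmorph0 in x0 *.
case/fS=> -[u s] [/= Uu sP xE]; exists (psi u, map psi s); split=> /=.
- by rewrite -iso_unit psiK.
- by move=> p /mapP[r /sP rP ->]; apply/iso_prime; rewrite psiK.
- by rewrite -[LHS]phiK xE rmorphM rmorph_prod big_map.
Qed.

End FactorialTransfer.

Section LastVariable.
Variables (K : fieldType) (n : nat).
Local Notation widen := (widen_ord (leqnSn n)).
Implicit Types (p : {mpoly K[n.+1]}) (c : {mpoly K[n]}) (x : 'I_n -> K) (t : K).

Definition extpt x t : 'I_n.+1 -> K :=
  fun i => if unlift ord_max i is Some j then x j else t.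

Lemma extpt_max x t : extpt x t ord_max = t.
Proof. by rewrite /extpt unlift_none. Qed.

Lemma extpt_widen x t i : extpt x t (widen i) = x i.
Proof.
have -> : widen i = lift ord_max i by apply: val_inj; rewrite /= /bump leqNgt ltn_ord.
by rewrite /extpt liftK.
Qed.

Lemma ord_max_or_widen (i : 'I_n.+1) : i = ord_max \/ exists j, i = widen j.
Proof.
case: (unliftP ord_max i) => [j ->|]; [right; exists j|by left].
by apply: val_inj; rewrite /= /bump leqNgt ltn_ord.
Qed.

Lemma extpt_proj (xi : 'I_n.+1 -> K) : extpt (xi \o widen) (xi ord_max) = xi.
Proof.
apply: functional_extensionality => i.
by have [->|[j ->]] := ord_max_or_widen i; rewrite ?extpt_max ?extpt_widen.
Qed.

Lemma proj_extpt x t : extpt x t \o widen = x.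
Proof. by apply: functional_extensionality => i /=; rewrite extpt_widen. Qed.

(** Intended as the inverse of [muni]. Being a composite of ring morphisms it is one too, so
    primality and divisibility transfer both ways. *)
Definition multi : {poly {mpoly K[n]}} -> {mpoly K[n.+1]} :=
  horner_eval 'X_ord_max \o map_poly (@mwiden n K).

HB.instance Definition _ := GRing.RMorphism.on multi.

Lemma muniX m : muni 'X_[m] =
  'X_[K, [multinom m (widen i) | i < n]] *: 'X^(m ord_max).
Proof. by rewrite muniE msuppX big_seq1 mcoeffX eqxx scale1r. Qed.

Lemma muniK : cancel (@muni n K) multi.
Proof.
elim/mpolyind => [|c m p _ _ IH]; first by rewrite !rmorph0.
rewrite !rmorphD /= IH muniZ muniX; congr (_ + _).
rewrite -!mul_polyC !rmorphM /= /multi /= /horner_eval !map_polyC map_polyXn /=.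
rewrite !hornerC hornerXn mwidenC mwidenX mul_mpolyC mpolyXn -mpolyXD.
congr (_ *: 'X_[_]); apply/mnmP => i; rewrite mnmDE mulmnE.
have [->|[j ->]] := ord_max_or_widen i.
  by rewrite mnmwiden_ordmax mnm1E eqxx mul1n.
by rewrite mnmwiden_widen mnmE mnm1E -val_eqE /= gtn_eqF ?mul0n ?addn0.
Qed.

Lemma muni_mwiden c : muni (mwiden c) = c%:P.
Proof.
elim/mpolyind: c => [|a m p _ _ IH]; first by rewrite !rmorph0.
rewrite !rmorphD /= IH mwidenZ mwidenX muniZ muniX mnmwiden_ordmax expr0.
rewrite alg_polyC -mul_polyC -polyCM mul_mpolyC; congr ((_ *: 'X_[_])%:P + _).
by apply/mnmP => i; rewrite mnmE mnmwiden_widen.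
Qed.

Lemma muni_max : muni 'X_ord_max = 'X :> {poly {mpoly K[n]}}.
Proof.
rewrite muniX mnm1E eqxx expr1 (_ : [multinom _ | _ < _] = 0%MM) ?mpolyX0 ?scale1r //.
by apply/mnmP=> i; rewrite mnmE mnm1E mnm0E -val_eqE /= gtn_eqF.
Qed.

Lemma multiK : cancel multi (@muni n K).
Proof.
move=> q; rewrite /multi /= /horner_eval -horner_map /= muni_max -map_poly_comp /=.
rewrite (eq_map_poly muni_mwiden) -[RHS]comp_polyXr /comp_poly.
by congr (_.[_]); apply: eq_map_poly.
Qed.

Lemma meval_mwiden c x t : (mwiden c).@[extpt x t] = c.@[x].
Proof.
elim/mpolyind: c => [|a m p _ _ IH]; first by rewrite !rmorph0.
rewrite !rmorphD /= IH mwidenZ !mevalZ mwidenX !mevalX big_ord_recr /=.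
rewrite mnmwiden_ordmax expr0 mulr1; congr (_ * _ + _).
by apply: eq_bigr => i _; rewrite mnmwiden_widen extpt_widen.
Qed.

Lemma meval_extpt p x t : p.@[extpt x t] = (map_poly (meval x) (muni p)).[t].
Proof.
rewrite -{1}[p]muniK /multi /= /horner_eval -horner_map /= mevalXU extpt_max.
rewrite -map_poly_comp /=; congr (_.[_]); apply: eq_map_poly => c /=.
exact: meval_mwiden.
Qed.

(** Substituting [t] for the last variable gives the equation of the restriction to the hyperplane
    [x_last = t]. *)
Lemma meval_slice p x t : ((muni p).[t%:MP]).@[x] = p.@[extpt x t].
Proof. by rewrite meval_extpt -{2}[t](mevalC x) horner_map. Qed.

Lemma muni_prime p : prime_elt (muni p) <-> prime_elt p.
Proof. exact: (iso_prime muniK multiK). Qed.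

Lemma muni_divides p q : divides (muni p) (muni q) <-> divides p q.
Proof. exact: (iso_divides muniK multiK). Qed.

End LastVariable.

Lemma factorial_mpoly (K : fieldType) n : factorial_ring {mpoly K[n]}.
Proof.
elim: n => [p p0|n IH]; last exact: iso_factorial (@muniK K n) (@multiK K n) (factorial_poly IH).
exists (p, [::]); split=> //=; last by rewrite big_nil mulr1.
rewrite (nvar0_mpolyC p) rmorph_unit // unitfE.
by apply: contraNneq p0 => p00; rewrite (nvar0_mpolyC p) p00.
Qed.

(** * Hypersurfaces have codimension one *)

Section Nullstellensatz.
Variable K : closedFieldType.

Lemma poly_nonvanishing (p : {poly K}) : p != 0 -> exists t, p.[t] != 0.
Proof. by move/closed_nonrootP=> [t]; exists t. Qed.

Lemma mpoly_nonvanishing n (p : {mpoly K[n]}) : p != 0 -> exists x, p.@[x] != 0.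
Proof.
elim: n p => [|n IH] p p0.
  exists (fun=> 0); rewrite (nvar0_mpolyC p) mevalC.
  by apply: contraNneq p0 => p00; rewrite (nvar0_mpolyC p) p00.
have : lead_coef (muni p) != 0.
  by rewrite lead_coef_eq0; apply: contraNneq p0 => p0; rewrite -[p]muniK p0 rmorph0.
case/IH => x lx; have [|t pt] := @poly_nonvanishing (map_poly (meval x) (muni p)).
  apply: contraNneq lx => /(congr1 (fun q : {poly K} => q`_(size (muni p)).-1)).
  by rewrite coef_map coef0 => ->.
by exists (extpt x t); rewrite meval_extpt.
Qed.

Lemma mpoly_vanishing n (p : {mpoly K[n]}) : (forall x, p.@[x] = 0) -> p = 0.
Proof.
move=> pv; apply/eqP; apply: contraT => /mpoly_nonvanishing[x].
by rewrite pv eqxx.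
Qed.

Definition zero_locus n (q : {mpoly K[n]}) (x : 'I_n -> K) : Prop := q.@[x] = 0.

(** The induction step on the number of variables, with the outer variable singled out. If [q] has
    positive degree in it, the gcd of [q] and [f] decides: were it constant in that variable, Bezout
    would give a point where [q] vanishes and [f] does not. *)
Lemma poly_nullstellensatz n (q f : {poly {mpoly K[n]}}) :
  (forall c h : {mpoly K[n]}, prime_elt c ->
     subs (zero_locus c) (zero_locus h) -> divides c h) ->
  prime_elt q ->
  (forall x t, (map_poly (meval x) q).[t] = 0 -> (map_poly (meval x) f).[t] = 0) ->
  divides q f.
Proof.
move=> IH qP qf; have [q0 _ qM] := qP.
have [le1|gt1] := leqP (size q) 1.
  have qE := size1_polyC le1; rewrite qE in qP qf *; apply/divides_polyC => i.
  apply: IH (prime_of_polyC qP) _ => x qx; rewrite /zero_locus -coef_map.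
  suff -> : map_poly (meval x) f = 0 by rewrite coef0.
  apply/eqP; apply: contraT => /poly_nonvanishing[t] /eqP[].
  by apply: qf; rewrite map_polyC hornerC.
have lead0 : lead_coef q != 0 by rewrite lead_coef_eq0.
have /Pdiv.Idomain.dvdpP[[c s] /= c0 qE] := dvdp_gcdl q f.
have /Pdiv.Idomain.dvdpP[[c' s'] /= c'0 fE] := dvdp_gcdr q f.
(* The prime [q] divides [c q = s * gcd]. If it divides [s], cancelling [q] makes the gcd a divisor
   of the constant [c]; if it divides the gcd, then [q] divides [c' f] and, for degree reasons, not
   [c']. *)
have [[e sE]|[e gE]] : divides q s \/ divides q (gcdp q f).
- by apply: qM; rewrite -qE -mul_polyC; apply/dividesMl/dividesxx.
- have eg : c%:P = e * gcdp q f.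
    by apply: (mulfI q0); rewrite mulrC mul_polyC qE sE; ring.
  have e0 : e != 0.
    by apply: contraNneq c0 => e0; rewrite -polyC_eq0 eg e0 mul0r.
  have g0 : gcdp q f != 0 by rewrite gcdp_eq0 (negbTE q0).
  have : (size (e * gcdp q f)%R <= 1)%N by rewrite -eg size_polyC_leq1.
  rewrite size_mul // => sg; have {sg} sg : (size (gcdp q f) <= 1)%N.
    by move: e0; rewrite -size_poly_gt0; lia.
  have gE := size1_polyC sg; set k := _`_0 in gE.
  have k0 : k != 0 by rewrite -polyC_eq0 -gE.
  have [[a b] /= /eqpP[[k1 k2] /= /andP[k10 k20] bez]] := Bezoutp q f.
  (* Over this [x] the leading coefficient survives, so [q] still has positive degree and a root
     [t]; there the Bezout combination is [0], although its right-hand side is nonzero. *)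
  have [|x] := @mpoly_nonvanishing n (k2 * k * lead_coef q); first by rewrite !mulf_neq0.
  rewrite !mevalM !mulf_eq0 !negb_or => /andP[/andP[k2x kx] leadx].
  have sx : size (map_poly (meval x) q) = size q by apply: size_map_poly_id0.
  have /closed_rootP[t /eqP qt] : size (map_poly (meval x) q) != 1%N by rewrite sx gtn_eqF.
  have /(congr1 (fun h => (map_poly (meval x) h).[t])) := bez.
  rewrite gE -!mul_polyC !rmorphM !rmorphD !rmorphM /= !map_polyC !hornerE /=.
  rewrite qt (qf _ _ qt) !mulr0 addr0 mulr0 => /esym/eqP.
  by rewrite mulf_eq0 (negbTE k2x) (negbTE kx).
- have [[k kE]|//] : divides q c'%:P \/ divides q f.
    by apply: qM; rewrite mul_polyC fE gE; apply/dividesMl/dividesMl/dividesxx.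
  have k0 : k != 0.
    by apply: contraNneq c'0 => k0; rewrite -polyC_eq0 kE k0 mul0r.
  rewrite -size_poly_gt0 in k0; have := leq_add k0 gt1.
  have := size_polyC_leq1 c'; rewrite kE size_mul -?size_poly_gt0 ?(ltnW gt1) //.
  by rewrite -subn1 leq_subLR leqNgt => /negbTE->.
Qed.

Theorem prime_nullstellensatz n (q f : {mpoly K[n]}) : prime_elt q ->
  subs (zero_locus q) (zero_locus f) -> divides q f.
Proof.
elim: n q f => [|n IH] q f qP qf.
  (* In zero variables every nonzero polynomial is a unit, so there are no primes. *)
  have [q0 /negP[]] := qP; rewrite (nvar0_mpolyC q) rmorph_unit // unitfE.
  by apply: contraNneq q0 => q00; rewrite (nvar0_mpolyC q) q00.
apply/muni_divides/poly_nullstellensatz; first exact: IH.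
  exact/muni_prime.
move=> x t qx; have fe := meval_extpt f x t; have qe := meval_extpt q x t.
by have := qf (extpt x t); rewrite /zero_locus fe qe; apply.
Qed.

Lemma mpoly_unit_constant n (p : {mpoly K[n]}) : p \is a GRing.unit -> p = (p@_0%MM)%:MP.
Proof. by case/andP=> /eqP. Qed.

Lemma mpoly_prime_divisor n (q : {mpoly K[n]}) : q != 0 -> q \isn't a GRing.unit ->
  exists2 p, prime_elt p & subs (zero_locus p) (zero_locus q).
Proof.
move=> q0 nUq; have [p pP [c qE]] := factorial_prime_divisor (@factorial_mpoly K n) q0 nUq.
by exists p => // x px; rewrite /zero_locus qE mevalM px mulr0.
Qed.

(** On an empty locus [1] vanishes vacuously, so [q] would divide [1]. *)
Lemma prime_locus_nonempty n (q : {mpoly K[n]}) : prime_elt q -> exists x, zero_locus q x.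
Proof.
move=> qP; apply: NNPP => /not_ex_all_not none.
have /(prime_ndivides_unit qP (unitr1 _)) : divides q 1; last by [].
by apply: (prime_nullstellensatz qP) => x /none.
Qed.

Lemma nonunit_locus_nonempty n (q : {mpoly K[n]}) : q \isn't a GRing.unit ->
  exists x, zero_locus q x.
Proof.
have [-> _|q0 nUq] := eqVneq q 0; first by exists (fun=> 0); rewrite /zero_locus meval0.
have [p pP pq] := mpoly_prime_divisor q0 nUq.
by have [x /pq] := prime_locus_nonempty pP; exists x.
Qed.

(** Primality of the vanishing ideal suffices: if neither [Z1] nor [Z2] contains [S], an equation of
    each fails somewhere on [S], yet their product vanishes on [S]. *)
Lemma irreducible_closed_vanishing n (S : ('I_n -> K) -> Prop) : zclosed S ->
  (exists x, S x) ->
  (forall f g, subs S (zero_locus (f * g)) -> subs S (zero_locus f) \/ subs S (zero_locus g)) ->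
  irreducible_closed S.
Proof.
move=> cS neS SP; split=> // Z1 Z2 [F1 Z1E] [F2 Z2E] SZ.
apply: NNPP => /not_or_and[nZ1 nZ2].
have wit Z (F : {mpoly K[n]} -> Prop) :
    (forall xi, Z xi <-> forall p, F p -> p.@[xi] = 0) -> ~ subs S Z ->
    exists2 p, F p & ~ subs S (zero_locus p).
  move=> ZE nZ; apply: NNPP => nex; apply: nZ => x Sx; apply/ZE => p Fp.
  by apply: NNPP => px; apply: nex; exists p => // pS; apply/px/pS.
have [f F1f nf] := wit _ _ Z1E nZ1; have [g F2g ng] := wit _ _ Z2E nZ2.
have [] := SP f g; last 2 first; [exact: nf | exact: ng |].
move=> x /SZ[/Z1E/(_ f F1f)|/Z2E/(_ g F2g)] e; rewrite /zero_locus mevalM e.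
  by rewrite mul0r.
by rewrite mulr0.
Qed.

Lemma zero_locus_closed n (q : {mpoly K[n]}) : zclosed (zero_locus q).
Proof. by exists (eq q) => x; split=> [qx _ <-|/(_ q erefl)]. Qed.

Lemma prime_locus_irreducible n (q : {mpoly K[n]}) : prime_elt q ->
  irreducible_closed (zero_locus q).
Proof.
move=> qP; apply: irreducible_closed_vanishing.
- exact: zero_locus_closed.
- exact: prime_locus_nonempty.
have [_ _ qM] := qP => f g /(prime_nullstellensatz qP)/qM[][c ->]; [left|right];
  by move=> x qx; rewrite /zero_locus mevalM qx mulr0.
Qed.

(** * Chains of irreducible closed sets inside a hypersurface *)

Definition slice n (S : ('I_n -> K) -> Prop) (t : K) : ('I_n.+1 -> K) -> Prop :=
  fun xi => S (xi \o widen_ord (leqnSn n)) /\ xi ord_max = t.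

Lemma slice_irreducible n (S : ('I_n -> K) -> Prop) t :
  irreducible_closed S -> irreducible_closed (slice S t).
Proof.
move=> [[F SE] [x0 Sx0] SP]; split.
- exists (fun p => (exists2 c, F c & p = mwiden c) \/ p = 'X_ord_max - t%:MP) => xi.
  rewrite -[xi]extpt_proj; move: (xi \o _) (xi ord_max) => x s.
  rewrite /slice proj_extpt extpt_max; split=> [[/SE Sx ->] p [[c Fc ->]|->]|Fp].
  + by rewrite meval_mwiden; exact: Sx.
  + by rewrite mevalB mevalXU mevalC extpt_max subrr.
  split; last first.
    have /eqP := Fp _ (or_intror erefl).
    by rewrite mevalB mevalXU mevalC extpt_max subr_eq0 => /eqP.
  by apply/SE => c Fc; rewrite -(meval_mwiden c x s); apply: Fp; left; exists c.
- by exists (extpt x0 t); rewrite /slice proj_extpt extpt_max.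
(* Closed sets pull back along [x |-> (x, t)], so a cover of the slice gives a cover of [S]. *)
have pull Z : zclosed Z -> zclosed (fun x => Z (extpt x t)).
  case=> G ZE; exists (fun p => exists2 g, G g & p = (muni g).[t%:MP]) => x.
  split=> [/ZE Zx _ [g Gg ->]|Gx]; first by rewrite meval_slice; apply: Zx.
  by apply/ZE => g Gg; rewrite -meval_slice; apply: Gx; exists g.
move=> Z1 Z2 /pull cZ1 /pull cZ2 SZ; have [|sZ|sZ] := SP _ _ cZ1 cZ2.
- by move=> x Sx; apply: SZ; rewrite /slice proj_extpt extpt_max.
- by left=> xi [/sZ Zxi xit]; rewrite -xit extpt_proj in Zxi.
- by right=> xi [/sZ Zxi xit]; rewrite -xit extpt_proj in Zxi.
Qed.

Lemma affine_space_irreducible n : irreducible_closed (fun _ : 'I_n -> K => True).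
Proof.
apply: irreducible_closed_vanishing.
- by exists (fun=> False).
- by exists (fun=> 0).
move=> f g fg; have /eqP : f * g = 0 by apply: mpoly_vanishing => x; apply: fg.
by rewrite mulf_eq0 => /orP[]/eqP->; [left|right] => x _; rewrite /zero_locus meval0.
Qed.

(** Expresses that [S] has dimension at least [k], in the form in which [codim_ge2] can be
    applied. *)
Definition has_chain n (S : ('I_n -> K) -> Prop) (k : nat) :=
  exists Z : nat -> ('I_n -> K) -> Prop,
    (forall i, (i <= k)%N -> irreducible_closed (Z i) /\ subs (Z i) S) /\
    (forall i, (i < k)%N -> subs (Z i) (Z i.+1) /\ ~ subs (Z i.+1) (Z i)).

Lemma codim_ge2_no_chain n (S T : ('I_n.+1 -> K) -> Prop) :
  subs S T -> has_chain S n -> ~ codim_ge2 T.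
Proof.
move=> ST [Z [ZS Zlt]] /(_ n Z) cT; have /cT/(_ Zlt) : forall i, (i <= n)%N ->
  irreducible_closed (Z i) /\ subs (Z i) T; last by lia.
by move=> i /ZS[iZ ZiS]; split=> // x /ZiS/ST.
Qed.

(** A chain of [S], copied into the hyperplane [x_last = t], is extended by [T] on top; the last
    inclusion is strict because [T] is not contained in the slice. *)
Lemma has_chain_slice n (S : ('I_n -> K) -> Prop) T T' t k :
  has_chain S k -> irreducible_closed T -> subs T T' ->
  subs (slice S t) T -> ~ subs T (slice S t) -> has_chain T' k.+1.
Proof.
move=> [Z [ZS Zlt]] iT TT' ST nTS.
exists (fun i => if (i <= k)%N then slice (Z i) t else T); split=> i ik.
  case: ifP => [/ZS[iZ ZiS]|_]; last by split.
  by split=> [|xi [/ZiS ? ?]]; [exact: slice_irreducible | apply/TT'/ST].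
move: ik; rewrite ltnS leq_eqVlt => /predU1P[->|ik].
  rewrite eqxx ltnn /=; have [_ ZkS] := ZS k (leqnn k).
  split=> [xi [/ZkS ? ?]|TZ]; first exact: ST.
  by apply: nTS => xi /TZ[/ZkS].
rewrite ik orbT; have [Zi nZi] := Zlt i ik.
split=> [xi [/Zi ? ?]|sZ]; first by split.
apply: nZi => x Zx; have := sZ (extpt x t).
by rewrite /slice proj_extpt extpt_max => /(_ (conj Zx erefl))[].
Qed.

Lemma mpolyX_neq0 n (i : 'I_n) : ('X_i : {mpoly K[n]}) != 0.
Proof.
apply/eqP => /(congr1 (meval (fun=> 1))); rewrite mevalXU meval0 => /eqP.
by rewrite oner_eq0.
Qed.

Lemma mpolyX_nonunit n (i : 'I_n) : ('X_i : {mpoly K[n]}) \isn't a GRing.unit.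
Proof.
apply/negP => /mpoly_unit_constant/(congr1 (meval (fun=> 1) \o (fun p => p))) /=.
rewrite mcoeffX mevalC mevalXU (_ : (U_(i) == 0)%MM = false) ?mulr0n.
  by move/eqP; rewrite oner_eq0.
by apply/eqP => /mnmP/(_ i); rewrite mnm1E eqxx mnm0E.
Qed.

(* Cut by [x_last = t]: either some slice is again a hypersurface of the hyperplane, or
   the equation involves [x_last] only and a whole hyperplane is contained in its locus. *)
Lemma hypersurface_chain n (q : {mpoly K[n.+1]}) : q != 0 -> q \isn't a GRing.unit ->
  has_chain (zero_locus q) n.
Proof.
elim: n q => [|n IH] q0 q0n nUq0; have [q qP qq0] := mpoly_prime_divisor q0n nUq0.
  exists (fun=> zero_locus q); split=> // i _; split=> //; exact: prime_locus_irreducible.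
(* Whether some coefficient of [q] in the last variable is nonconstant, witnessed by a monomial [m]
   other than [1]. *)
have [[i [m [m0 qim]]]|const] :=
  classic (exists i m, m != 0%MM /\ ((muni q)`_i)@_m != 0).
  (* [r.[t]] is the coefficient of [m] in the slice at [t], so the slice equation is nonzero and
     nonconstant wherever [r] does not vanish. *)
  pose r : {poly K} := map_poly (mcoeff m) (muni q).
  have rE t : ((muni q).[t%:MP])@_m = r.[t].
    rewrite (horner_coef_wide _ (size_poly _ _)) horner_coef raddf_sum.
    by apply: eq_bigr => j _; rewrite coef_map /= -rmorphXn mulrC mcoeffCM mulrC.
  have r0 : r != 0.
    by apply: contraNneq qim => r0; rewrite -[_@_m](coef_map (mcoeff m)) -/r r0 coef0.
  have nUslice t : r.[t] != 0 -> (muni q).[t%:MP] \isn't a GRing.unit.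
    rewrite -rE; apply: contraNN => /mpoly_unit_constant ->.
    by rewrite mcoeffC eq_sym (negbTE m0) mulr0.
  have [t rt] := poly_nonvanishing r0.
  (* A second good value [t'], different from [t]: the locus has a point over [t'], so it does not
     lie in the slice at [t]. *)
  have [|t'] := @poly_nonvanishing (r * ('X - t%:P)).
    by rewrite mulf_neq0 // polyXsubC_eq0.
  rewrite hornerM mulf_eq0 !hornerE subr_eq0 => /norP[rt' tt'].
  have slice0 : (muni q).[t%:MP] != 0.
    by apply: contraNneq rt; rewrite -rE => ->; rewrite mcoeff0.
  apply: (has_chain_slice (t := t) (IH _ slice0 (nUslice _ rt))
            (prime_locus_irreducible qP) qq0).
    by move=> xi [+ xit]; rewrite /zero_locus meval_slice -xit extpt_proj.
  have [x qx] := nonunit_locus_nonempty (nUslice _ rt').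
  move=> /(_ (extpt x t')); rewrite /zero_locus -meval_slice => /(_ qx)[_].
  by rewrite extpt_max => /eqP; rewrite (negbTE tt').
pose r : {poly K} := map_poly (mcoeff 0%MM) (muni q).
have qE : muni q = map_poly (@mpolyC n.+1 K) r.
  apply/polyP => i; rewrite !coef_map /=; apply/mpolyP => m; rewrite mcoeffC.
  have [->|m0] := eqVneq; rewrite ?mulr1 // mulr0.
  by apply/eqP; apply: contraT => qim; case: const; exists i, m; split=> //; rewrite eq_sym.
have [t rt] : exists t, root r t.
  apply/closed_rootP; apply/eqP => r1; have [_ /negP[]] := qP.
  have rE : r = (r`_0)%:P by apply: size1_polyC; rewrite r1.
  rewrite -[q]muniK qE rE map_polyC /= -muniC muniK rmorph_unit // unitfE.
  by rewrite -polyC_eq0 -rE -size_poly_eq0 r1.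
(* The hyperplane at the root [t] lies in the locus. Inside it, the chain is obtained by applying
   the induction hypothesis to a coordinate hyperplane. *)
have X0 : ('X_ord0 : {mpoly K[n.+1]}) != 0.
  exact: mpolyX_neq0.
apply: (has_chain_slice (t := t) (IH _ X0 (mpolyX_nonunit _))
          (slice_irreducible t (affine_space_irreducible n.+1))).
- move=> xi [_ xit]; apply: qq0; rewrite /zero_locus -[xi]extpt_proj xit.
  rewrite meval_extpt qE -map_poly_comp map_poly_id; first exact/rootP.
  by move=> c _ /=; exact: mevalC.
- by move=> xi [].
move=> /(_ (extpt (fun=> 1) t)); rewrite /slice proj_extpt extpt_max.
by move=> /(_ (conj I erefl))[]; rewrite /zero_locus mevalXU => /eqP; rewrite oner_eq0.
Qed.

End Nullstellensatz.

(** * Wedge and contraction operators *)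

Section CreationAnnihilation.
Variables (R : comNzRingType) (n : nat).
Local Notation E := {ffun {set 'I_n} -> R^o}.
Implicit Types (X Y : E) (I : {set 'I_n}) (i j : 'I_n).

Definition eps I i : R := (-1) ^+ #|[set m in I | (i < m)%N]|.

(* [rop i X = X /\ e_i], and [cop i] is its adjoint for the pairing: moving [e_i] to the
   last place costs the sign [eps]. *)
Definition rop i X : E :=
  [ffun I : {set 'I_n} => (if i \in I then eps I i * X (I :\ i) else 0 : R^o)].
Definition cop i X : E :=
  [ffun I : {set 'I_n} => (if i \in I then 0 else eps I i * X (i |: I) : R^o)].

Fact rop_linear i : linear (rop i).
Proof.
move=> a X Y; apply/ffunP => I; rewrite !ffunE; case: ifP => _; last by rewrite scaler0 addr0.
by rewrite /GRing.scale /=; ring.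
Qed.
HB.instance Definition _ i := GRing.isLinear.Build R E E *:%R (rop i) (rop_linear i).

Fact cop_linear i : linear (cop i).
Proof.
move=> a X Y; apply/ffunP => I; rewrite !ffunE; case: ifP => _; first by rewrite scaler0 addr0.
by rewrite /GRing.scale /=; ring.
Qed.
HB.instance Definition _ i := GRing.isLinear.Build R E E *:%R (cop i) (cop_linear i).

Lemma eps_sqr I i : eps I i * eps I i = 1.
Proof. by rewrite /eps -signr_odd -expr2 sqrr_sign. Qed.

Lemma epsU1 I i j : j \notin I -> eps (j |: I) i = (-1) ^+ (i < j)%N * eps I i.
Proof.
move=> jI; rewrite /eps -exprD; congr (_ ^+ _).
have [ij|ji] := boolP (i < j)%N.
  rewrite (_ : [set _ in _ | _] = j |: [set m in I | (i < m)%N]).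
    by rewrite cardsU1 inE (negbTE jI).
  by apply/setP => m; rewrite !inE; case: eqVneq => [->|].
rewrite add0n; apply: eq_card => m; rewrite !inE; case: eqVneq => [->|//].
by rewrite (negbTE ji) (negbTE jI) andbF.
Qed.

Lemma epsD1 I i j : j \in I -> eps (I :\ j) i = (-1) ^+ (i < j)%N * eps I i.
Proof.
by move=> jI; rewrite -{2}(setD1K jI) epsU1 ?setD11 // mulrA -expr2 sqrr_sign mul1r.
Qed.

Lemma sign_lt_anti i j : i != j -> (-1) ^+ (i < j)%N = - (-1) ^+ (j < i)%N :> R.
Proof.
by rewrite -val_eqE neq_ltn => /orP[] ij; rewrite ij ltnNge ltnW //= ?expr0 ?expr1 ?opprK.
Qed.

Lemma rop_rop i j X : rop i (rop j X) = - rop j (rop i X).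
Proof.
apply/ffunP => I; rewrite !ffunE; have [->|ij] := eqVneq i j.
  by case: ifP; rewrite ?oppr0 // !inE eqxx /= mulr0 oppr0.
rewrite !inE ij eq_sym ij /=; case: ifP => iI; case: ifP => jI; rewrite ?(mulr0, oppr0) //.
rewrite !epsD1 // (sign_lt_anti ij) !setDDl setUC; ring.
Qed.

(** The canonical anticommutation relation between annihilation and creation operators; later
    contraction identities reduce to it without further sign counting. *)
Lemma cop_rop i j X : cop i (rop j X) = (i == j)%:R *: X - rop j (cop i X).
Proof.
apply/ffunP => I; rewrite !ffunE.
rewrite /GRing.scale /=.
have [->|ij] := eqVneq i j.
  rewrite mul1r setU11 setD11; case: ifPn => jI.
    by rewrite (setD1K jI) epsD1 // ltnn mul1r mulrA eps_sqr mul1r subrr.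
  by rewrite (setU1K jI) epsU1 // ltnn mul1r mulrA eps_sqr mul1r subr0.
rewrite mul0r !inE ij eq_sym (negbTE ij) /= sub0r.
case: ifP => iI; case: ifP => jI; rewrite ?(mulr0, oppr0) //.
rewrite epsU1 ?iI // epsD1 // (sign_lt_anti ij).
rewrite (_ : (i |: I) :\ j = i |: I :\ j); first by ring.
by apply/setP => m; rewrite !inE; case: (eqVneq m i) => [->|]; rewrite ?ij ?andbF.
Qed.

(** [Rv u] is right wedge multiplication by the vector [u], and [Cv g] is contraction with the
    covector [g]. *)
Definition Rv (u : 'rV[R]_n) X : E := \sum_i u 0 i *: rop i X.
Definition Cv (g : 'rV[R]_n) X : E := \sum_i g 0 i *: cop i X.

Fact Rv_linear u : linear (Rv u).
Proof.
move=> a X Y; rewrite /Rv scaler_sumr -big_split; apply: eq_bigr => i _ /=.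
by rewrite linearP scalerDr !scalerA mulrC.
Qed.
HB.instance Definition _ u := GRing.isLinear.Build R E E *:%R (Rv u) (Rv_linear u).

Fact Cv_linear g : linear (Cv g).
Proof.
move=> a X Y; rewrite /Cv scaler_sumr -big_split; apply: eq_bigr => i _ /=.
by rewrite linearP scalerDr !scalerA mulrC.
Qed.
HB.instance Definition _ g := GRing.isLinear.Build R E E *:%R (Cv g) (Cv_linear g).

Definition dot (g u : 'rV[R]_n) := \sum_i g 0 i * u 0 i.

Lemma Cv_rop g i X : Cv g (rop i X) = g 0 i *: X - rop i (Cv g X).
Proof.
transitivity (\sum_j ((g 0 j * (j == i)%:R) *: X - rop i (g 0 j *: cop j X))).
  by apply: eq_bigr => j _; rewrite cop_rop scalerBr scalerA [rop i (_ *: _)]linearZ.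
rewrite sumrB -scaler_suml -linear_sum (bigD1 i) //= eqxx mulr1 big1 ?addr0 // => j ji.
by rewrite (negbTE ji) mulr0.
Qed.

Lemma Cv_Rv g u X : Cv g (Rv u X) = dot g u *: X - Rv u (Cv g X).
Proof.
rewrite {1}/Rv linear_sum /= /Rv /dot scaler_suml -sumrB; apply: eq_bigr => i _.
by rewrite linearZ /= Cv_rop scalerBr scalerA mulrC.
Qed.

Lemma Rv_rop u i X : Rv u (rop i X) = - rop i (Rv u X).
Proof.
rewrite /Rv linear_sum -sumrN; apply: eq_bigr => j _.
by rewrite /= linearZ rop_rop scalerN.
Qed.

Lemma Rv_Rv u v X : Rv u (Rv v X) = - Rv v (Rv u X).
Proof.
transitivity (\sum_i - (v 0 i *: rop i (Rv u X))); last by rewrite sumrN.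
rewrite [Rv v X]/Rv linear_sum; apply: eq_bigr => i _ /=.
by rewrite linearZ /= Rv_rop scalerN.
Qed.

(* For [M] antisymmetric, [W2 M] is the product with twice the bivector
   [\sum_(i < j) M i j e_i /\ e_j]. *)
Definition W2 (M : 'M[R]_n) X : E := \sum_i Rv (row i M) (rop i X).

Fact W2_linear M : linear (W2 M).
Proof.
move=> a X Y; rewrite /W2 scaler_sumr -big_split; apply: eq_bigr => i _ /=.
by rewrite !linearP.
Qed.
HB.instance Definition _ M := GRing.isLinear.Build R E E *:%R (W2 M) (W2_linear M).

Lemma Rv_W2 u M X : Rv u (W2 M X) = W2 M (Rv u X).
Proof.
rewrite /W2 linear_sum; apply: eq_bigr => i _ /=.
by rewrite Rv_Rv Rv_rop linearN opprK.
Qed.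

Lemma RvD u v X : Rv (u + v) X = Rv u X + Rv v X.
Proof. by rewrite /Rv -big_split; apply: eq_bigr => i _; rewrite mxE scalerDl. Qed.

Lemma RvZ a u X : Rv (a *: u) X = a *: Rv u X.
Proof. by rewrite /Rv scaler_sumr; apply: eq_bigr => i _; rewrite mxE scalerA. Qed.

Lemma Rv_sum (I : Type) (r : seq I) (u : I -> 'rV[R]_n) X :
  Rv (\sum_(k <- r) u k) X = \sum_(k <- r) Rv (u k) X.
Proof.
elim: r => [|i r IH]; last by rewrite !big_cons RvD IH.
by rewrite !big_nil /Rv big1 // => i _; rewrite mxE scale0r.
Qed.

(** Moving the contraction past the two factors of each term leaves two corrections, both governed
    by [g *m M]: one through the scalars [dot g (row i M)], one through the sum of the
    [g 0 i *: row i M]. *)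
Lemma Cv_W2 g M X : M^T = - M -> g *m M = 0 -> Cv g (W2 M X) = W2 M (Cv g X).
Proof.
move=> Manti gM0; rewrite /W2 linear_sum /=.
have gMi i : dot g (row i M) = 0.
  transitivity (- (g *m M) 0 i); last by rewrite gM0 mxE oppr0.
  rewrite mxE -sumrN; apply: eq_bigr => j _.
  by have /matrixP/(_ j i) := Manti; rewrite !mxE => ->; rewrite mulrN.
transitivity (\sum_i (Rv (row i M) (rop i (Cv g X)) - Rv (g 0 i *: row i M) X)).
  apply: eq_bigr => i _; rewrite Cv_Rv gMi scale0r sub0r Cv_rop linearB linearZ /=.
  by rewrite opprB RvZ.
rewrite sumrB -Rv_sum -mulmx_sum_row gM0.
by rewrite [X in _ - X]big1 ?subr0 // => i _; rewrite mxE scale0r.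
Qed.

Lemma W2D M N X : W2 (M + N) X = W2 M X + W2 N X.
Proof. by rewrite /W2 -big_split; apply: eq_bigr => i _; rewrite linearD RvD. Qed.

Lemma W2Z a M X : W2 (a *: M) X = a *: W2 M X.
Proof. by rewrite /W2 scaler_sumr; apply: eq_bigr => i _; rewrite linearZ RvZ. Qed.

Lemma W2_outer (u v : 'rV[R]_n) X : W2 (u^T *m v) X = Rv v (Rv u X).
Proof.
rewrite /W2 [Rv u X]/Rv linear_sum; apply: eq_bigr => i _ /=.
rewrite linearZ /= -RvZ; congr (Rv _ _).
by apply/rowP => j; rewrite !mxE big_ord1 !mxE.
Qed.

(** * Homogeneous elements and contraction along dual families *)

Definition vac : E := [ffun I : {set 'I_n} => ((I == set0)%:R : R^o)].
Definition top : E := [ffun I : {set 'I_n} => ((I == setT)%:R : R^o)].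

Definition hom (d : nat) X := forall I, #|I| != d -> X I = 0.

Lemma hom_vac : hom 0 vac.
Proof. by move=> I; rewrite cards_eq0 ffunE => /negbTE->. Qed.

Lemma hom_rop d i X : hom d X -> hom d.+1 (rop i X).
Proof.
move=> hX I cI; rewrite ffunE; case: ifP => // iI; rewrite hX ?mulr0 //.
by move: cI; rewrite (cardsD1 i I) iI.
Qed.

Lemma hom_sum d (I : Type) (r : seq I) (P : pred I) (F : I -> E) :
  (forall k, P k -> hom d (F k)) -> hom d (\sum_(k <- r | P k) F k).
Proof.
move=> hF; apply: (big_ind (hom d)) => //; first by move=> J _; rewrite ffunE.
by move=> X Y hX hY J cJ; rewrite ffunE hX ?hY ?addr0.
Qed.

Lemma hom_Rv d u X : hom d X -> hom d.+1 (Rv u X).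
Proof.
by move=> hX; apply: hom_sum => i _ I cI; rewrite ffunE (hom_rop i hX) ?scaler0.
Qed.

Lemma hom_W2 d M X : hom d X -> hom d.+2 (W2 M X).
Proof. by move=> hX; apply: hom_sum => i _; apply/hom_Rv/hom_rop. Qed.

Lemma hom_iter_W2 k M : hom k.*2 (iter k (W2 M) vac).
Proof. by elim: k => [|k IH]; [exact: hom_vac | rewrite doubleS; apply: hom_W2]. Qed.

Lemma hom_top X : hom n X -> X = X setT *: top.
Proof.
move=> hX; apply/ffunP => I; rewrite !ffunE; have [->|nT] := eqVneq I setT.
  by rewrite /GRing.scale /= mulr1.
rewrite scaler0 hX //; apply: contraNneq nT => cI.
by rewrite eqEcard subsetT cardsT card_ord cI leqnn.
Qed.

Lemma Cv_vac g : Cv g vac = 0.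
Proof.
rewrite /Cv big1 // => i _; rewrite (_ : cop i vac = 0) ?scaler0 //.
apply/ffunP => I; rewrite !ffunE; case: ifP => // _.
by rewrite -subset0 subUset sub1set inE mulr0.
Qed.

Lemma Rv_top u : Rv u top = 0.
Proof.
rewrite /Rv big1 // => i _; rewrite (_ : rop i top = 0) ?scaler0 //.
apply/ffunP => I; rewrite !ffunE; case: ifP => // _.
by rewrite -subTset subsetD1 inE andbF mulr0.
Qed.

Section DualFamilies.
Variables (L : eqType) (g u : L -> 'rV[R]_n).
Hypothesis gu : forall a b, dot (g a) (u b) = (a == b)%:R.
Implicit Type r : seq L.

Definition contract r X : E := foldr (fun a => Cv (g a)) X r.

(* Contracting with [g a] undoes wedging with the dual vector [u a], so an element killed
   by every [g a] is recovered from its product with all the [u a], which has top degree. *)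
Lemma killed_multiple_contract r d X : uniq r -> hom d X -> (d + size r)%N = n ->
  {in r, forall a, Cv (g a) X = 0} -> exists c, X = c *: contract r top.
Proof.
elim: r d X => [|a r IH] d X /=.
  by rewrite addn0 => _ hX dn _; exists (X setT); apply: hom_top; rewrite -dn.
case/andP=> ar ur hX dn gX.
have gaX : Cv (g a) X = 0 by apply: gX; rewrite mem_head.
(* As [g a] kills [X], the anticommutator with [u a] is the identity on [X]; this trades [X] for an
   element one degree higher. *)
have XE : X = Cv (g a) (Rv (u a) X).
  by rewrite Cv_Rv gu eqxx scale1r gaX linear0 subr0.
have [||c cE] := IH d.+1 (Rv (u a) X) ur (hom_Rv _ hX); first by rewrite addSnnS.
  move=> b br; rewrite Cv_Rv gu gX ?inE ?br ?orbT // linear0 subr0.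
  by rewrite (negbTE (memPn ar b br)) scale0r.
by exists c; rewrite XE cE linearZ.
Qed.

Lemma Rv_contract_top r b : b \notin r -> Rv (u b) (contract r top) = 0.
Proof.
elim: r => [|a r IH] /=; first by rewrite Rv_top.
rewrite inE negb_or => /andP[ba br].
have := Cv_Rv (g a) (u b) (contract r top).
rewrite IH // linear0 gu eq_sym (negbTE ba) scale0r sub0r => /eqP.
by rewrite eq_sym oppr_eq0 => /eqP.
Qed.

(** Wedging with [u a] annihilates the shorter contraction, so the anticommutator recovers that
    contraction from the longer one; none of them can be zero. *)
Lemma contract_top_neq0 r : uniq r -> contract r top != 0.
Proof.
elim: r => [_|a r IH /= /andP[ar /IH]] /=.
  by apply/eqP => /ffunP/(_ setT)/eqP; rewrite !ffunE eqxx oner_eq0.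
apply: contraNneq => gr0; have := Cv_Rv (g a) (u a) (contract r top).
by rewrite Rv_contract_top // linear0 gu eqxx scale1r gr0 linear0 subr0 => <-.
Qed.

End DualFamilies.
End CreationAnnihilation.

(** * Rank and exterior powers of an alternating matrix *)

Section AlternatingRank.
Variables (K : fieldType) (n : nat).
Hypothesis K0 : [pchar K] =i pred0.
Local Notation E := {ffun {set 'I_n} -> K^o}.
Implicit Types (M : 'M[K]_n) (X : E).

Let natr_neq0 k : (k.+1%:R : K) != 0.
Proof. by move/pcharf0P: K0 => ->. Qed.

Lemma antisym_diag M i : M^T = - M -> M i i = 0.
Proof.
move=> /matrixP/(_ i i); rewrite !mxE => /eqP; rewrite -addr_eq0 -mulr2n -mulr_natr.
by rewrite mulf_eq0 (negbTE (natr_neq0 1)) orbF => /eqP.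
Qed.

Lemma Rv_Rv0 u X : Rv u (Rv u X) = 0.
Proof.
have /eqP := Rv_Rv u u X; rewrite -addr_eq0 -mulr2n -scaler_nat.
by rewrite scaler_eq0 (negbTE (natr_neq0 1)) => /eqP.
Qed.

Lemma dot_delta i (u : 'rV[K]_n) : dot (delta_mx 0 i) u = u 0 i.
Proof.
rewrite /dot (bigD1 i) //= mxE !eqxx mul1r big1 ?addr0 // => j ji.
by rewrite mxE eqxx (negbTE ji) mul0r.
Qed.

(** The extra term squares to zero and commutes with [W2 N], so the binomial expansion stops after
    two terms. *)
Lemma W2_split_iter M N (a b : 'rV[K]_n) d k X :
  (forall Y, W2 M Y = W2 N Y + d *: Rv b (Rv a Y)) ->
  iter k.+1 (W2 M) X =
  iter k.+1 (W2 N) X + (k.+1%:R * d) *: Rv b (Rv a (iter k (W2 N) X)).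
Proof.
move=> MN; have TT Y : Rv b (Rv a (Rv b (Rv a Y))) = 0.
  by rewrite (Rv_Rv a b) linearN /= Rv_Rv0 oppr0.
elim: k => [|k IH]; first by rewrite /= MN mul1r.
rewrite iterS IH MN !(linearD, linearZ) /= TT !scaler0 addr0 -!Rv_W2 -addrA -scalerDl.
by congr (_ + _ *: _); rewrite [in RHS]mulrS; ring.
Qed.

(* Splitting off the hyperbolic plane spanned by [e_i] and [e_j], where [M i j != 0]. *)
Section Reduction.
Variables (M : 'M[K]_n) (i j : 'I_n).
Hypotheses (Manti : M^T = - M) (Mij : M i j != 0).
Let a := row i M.
Let b := row j M.
Let c := M i j.
(** The alternating analogue of a pivot step: rows and columns [i] and [j] of [N] vanish. *)
Let N := M - c^-1 *: (a^T *m b - b^T *m a).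

Let Mji : M j i = - c.
Proof. by have /matrixP/(_ i j) := Manti; rewrite !mxE. Qed.

Let NE k l : N k l = M k l - c^-1 * (M i k * M j l - M j k * M i l).
Proof. by rewrite !mxE !big_ord1 !mxE. Qed.

Lemma reduction_antisym : N^T = - N.
Proof.
apply/matrixP => k l; rewrite [LHS]mxE [RHS]mxE !NE.
by have /matrixP/(_ k l) := Manti; rewrite !mxE => ->; ring.
Qed.

Let Ni k : N k i = 0.
Proof.
rewrite NE Mji (antisym_diag i Manti) mulr0 subr0 mulrN -/c.
by have /matrixP/(_ i k) := Manti; rewrite !mxE => ->; field.
Qed.

Let Nj k : N k j = 0.
Proof.
rewrite NE (antisym_diag j Manti) mulr0 sub0r -/c.
by have /matrixP/(_ j k) := Manti; rewrite !mxE => ->; field.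
Qed.

(** The row space of [M] is the direct sum of that of [N] and the lines of [a] and [b]. Columns [i]
    and [j] detect this: they vanish on [N], and there [a] is [(0, c)] while [b] is [(- c, 0)]. *)
Lemma rank_reduction : \rank M = (\rank N).+2.
Proof.
have ai : a 0 i = 0 by rewrite mxE antisym_diag.
have bj : b 0 j = 0 by rewrite mxE antisym_diag.
have bi : b 0 i = - c by rewrite mxE Mji.
have aj : a 0 j = c by rewrite mxE.
have sclE (s : 'M[K]_1) (v : 'rV[K]_n) k : (s *m v) 0 k = s 0 0 * v 0 k.
  by rewrite mxE big_ord1.
have ME : (M :=: N + (a + b))%MS.
  apply/eqmxP/andP; split.
    rewrite -[X in (X <= _)%MS](subrK (c^-1 *: (a^T *m b - b^T *m a))) addmx_sub_adds //.
    rewrite scalemx_sub // addmx_sub ?eqmx_opp //.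
      by rewrite (submx_trans (submxMl _ _)) ?addsmxSr.
    by rewrite (submx_trans (submxMl _ _)) ?addsmxSl.
  rewrite !addsmx_sub !row_sub !andbT addmx_sub // eqmx_opp scalemx_sub //.
  by rewrite addmx_sub ?eqmx_opp // (submx_trans (submxMl _ _)) ?row_sub.
have NI : (N :&: (a + b) = 0)%MS.
  apply/eqP; rewrite -submx0; apply/rV_subP => x.
  rewrite sub_capmx => /andP[/submxP[y ->] /sub_addsmxP[[s t] /= e]].
  have y0 k : (forall m, N m k = 0) -> (y *m N) 0 k = 0.
    by move=> Nk; rewrite mxE big1 // => m _; rewrite Nk mulr0.
  have s0 : s = 0.
    apply/matrixP => u v; rewrite !ord1 mxE; have := y0 j Nj; rewrite e mxE !sclE bj aj mulr0 addr0.
    by move/eqP; rewrite mulf_eq0 (negbTE Mij) orbF => /eqP.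
  have t0 : t = 0.
    apply/matrixP => u v; rewrite !ord1 mxE; have := y0 i Ni; rewrite e mxE !sclE bi ai mulr0 add0r.
    by move/eqP; rewrite mulf_eq0 oppr_eq0 (negbTE Mij) orbF => /eqP.
  by rewrite e s0 t0 !mul0mx addr0 sub0mx.
have abI : (a :&: b = 0)%MS.
  apply/eqP; rewrite -submx0; apply/rV_subP => x.
  rewrite sub_capmx => /andP[/submxP[s ->] /submxP[t e]].
  have s0 : s = 0.
    apply/matrixP => u v; rewrite !ord1 mxE.
    have /matrixP/(_ 0 j) := e; rewrite !sclE bj aj mulr0.
    by move/eqP; rewrite mulf_eq0 (negbTE Mij) orbF => /eqP.
  by rewrite s0 mul0mx sub0mx.
rewrite ME mxrank_disjoint_sum // mxrank_disjoint_sum // !rank_rV.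
have -> : a != 0 by apply: contraNneq Mij => a0; rewrite -/c -aj a0 mxE.
have -> : b != 0 by apply: contraNneq Mij => b0; rewrite -/c -oppr_eq0 -bi b0 mxE.
by rewrite addn2.
Qed.

Let W2_MN X : W2 M X = W2 N X + (c^-1 * 2%:R) *: Rv b (Rv a X).
Proof.
have {1}-> : M = N + c^-1 *: (a^T *m b - b^T *m a) by rewrite /N subrK.
rewrite (W2D N) W2Z (W2D (a^T *m b)) -[- (b^T *m a)]scaleN1r W2Z.
rewrite !W2_outer (Rv_Rv a b) scaleN1r opprK.
by rewrite -mulr2n -scaler_nat scalerA.
Qed.

(** Contracting with the covectors of index [i] and then [j] kills every power of [W2 N] applied to
    [vac], and turns the remaining term into a multiple of [Y] by [-2 (k + 1) c], nonzero in
    characteristic 0. *)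
Lemma iter_W2_reduction k : iter k (W2 N) (vac K n) != 0 -> iter k.+1 (W2 M) (vac K n) != 0.
Proof.
set Y := iter k _ _ => Y0.
have kill l : (forall m, N m l = 0) -> forall k', Cv (delta_mx 0 l) (iter k' (W2 N) (vac K n)) = 0.
  move=> Nl; elim=> [|k' IH]; first exact: Cv_vac.
  rewrite iterS Cv_W2 ?IH ?linear0 //; first exact: reduction_antisym.
  rewrite -rowE; apply/rowP => m; rewrite [LHS]mxE [RHS]mxE.
  by have /matrixP/(_ m l) := reduction_antisym; rewrite [LHS]mxE [RHS]mxE Nl oppr0.
apply: contraNneq Y0; rewrite (W2_split_iter _ _ W2_MN) -/Y => e.
have := congr1 (Cv (delta_mx 0 i)) e; rewrite linearD linearZ linear0 /= -iterS.
rewrite (kill i Ni) add0r !Cv_Rv !dot_delta (kill i Ni) linear0 subr0.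
have -> : a 0 i = 0 by rewrite mxE antisym_diag.
rewrite scale0r linear0 subr0 => /(congr1 (Cv (delta_mx 0 j))).
rewrite linear0 linearZ /= linearZ /= Cv_Rv dot_delta (kill j Nj) linear0 subr0.
move/eqP; rewrite !scaler_eq0 !mulf_eq0 !mxE Mji oppr_eq0 (negbTE Mij).
by rewrite invr_eq0 (negbTE Mij) !(negbTE (natr_neq0 _)).
Qed.

End Reduction.

(** Each pivot step lowers the rank by two and the exponent by one. Evenness makes the halving in
    [(n - l)./2] exact; nonvanishing gives a nonzero power of the bivector at points of maximal
    rank. *)
Lemma antisym_rank M : M^T = - M ->
  exists2 k, \rank M = k.*2 & iter k (W2 M) (vac K n) != 0.
Proof.
move: {2}(\rank M) (leqnn (\rank M)) => m; elim/ltn_ind: m M => m IH M rM Manti.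
have [->|M0] := eqVneq M 0.
  exists 0; first by rewrite mxrank0.
  by apply/eqP => /ffunP/(_ set0)/eqP; rewrite !ffunE eqxx oner_eq0.
have [i [j Mij]] : exists i j, M i j != 0.
  by move: M0; rewrite -subr_eq0 => /matrix0Pn[i [j]]; rewrite subr0; exists i, j.
pose N := M - (M i j)^-1 *: ((row i M)^T *m row j M - (row j M)^T *m row i M).
have [||k rN kN] := IH _ _ N (leqnn (\rank N)).
- by rewrite (leq_trans _ rM) // (rank_reduction Manti Mij).
- exact: reduction_antisym.
exists k.+1; first by rewrite (rank_reduction Manti Mij) rN.
exact (iter_W2_reduction Manti Mij kN).
Qed.

End AlternatingRank.

(** * The wedge product in coordinates *)

Section WedgeProduct.
Variables (K : fieldType) (n : nat).
Local Notation A := {mpoly K[n]}.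
Local Notation E := {ffun {set 'I_n} -> A^o}.
Implicit Types (a b c D : E) (I J L : {set 'I_n}) (i j : 'I_n).

Lemma wedgeE a b L :
  wedge a b L = \sum_(I : {set 'I_n} | I \subset L) (-1) ^+ wsign I (L :\: I) * a I * b (L :\: I).
Proof.
rewrite ffunE [RHS]big_mkcond; apply: eq_bigr => I _ /=; case: ifPn => IL.
  rewrite (big_pred1 (L :\: I)) // => J; apply/andP/eqP => [[dIJ /eqP <-]|->].
    by rewrite setDUl setDv set0U; apply/esym/setDidPl; rewrite disjoint_sym.
  by rewrite setDE setUIr setUCr setIT (setUidPr IL) eqxx -setDE disjoints_subset setCD subsetUr.
rewrite big_pred0 // => J; apply: contraNF IL => /andP[_ /eqP <-].
exact: subsetUl.
Qed.

Lemma wsignUl I J L : [disjoint I & J] -> wsign (I :|: J) L = (wsign I L + wsign J L)%N.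
Proof.
move=> dIJ; rewrite /wsign -cardsUI [X in (_ + X)%N](_ : _ = 0%N) ?addn0.
  by apply: eq_card => p; rewrite !inE -!andb_orl.
apply/eqP; rewrite cards_eq0 -subset0; apply/subsetP => p; rewrite !inE.
by case/andP=> /andP[/andP[pI _] _] /andP[/andP[pJ _] _]; rewrite (disjointFr dIJ pI) in pJ.
Qed.

Lemma wsignUr I J L : [disjoint I & J] -> wsign L (I :|: J) = (wsign L I + wsign L J)%N.
Proof.
move=> dIJ; rewrite /wsign -cardsUI [X in (_ + X)%N](_ : _ = 0%N) ?addn0.
  by apply: eq_card => p; rewrite !inE -!andb_orl -andb_orr.
apply/eqP; rewrite cards_eq0 -subset0; apply/subsetP => p; rewrite !inE.
by case/andP=> /andP[/andP[_ pI] _] /andP[/andP[_ pJ] _]; rewrite (disjointFr dIJ pI) in pJ.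
Qed.

(** Both sides are sums over partitions of [L] into three blocks, [I], [S :\: I] and [L :\: S]; the
    inversion count is additive over disjoint unions in each argument, so the signs agree. *)
Lemma wedgeA a b c : wedge a (wedge b c) = wedge (wedge a b) c.
Proof.
apply/ffunP => L; rewrite !wedgeE.
transitivity (\sum_(S : {set 'I_n} | S \subset L) \sum_(I : {set 'I_n} | I \subset S)
    (-1) ^+ (wsign S (L :\: S) + wsign I (S :\: I)) * a I * b (S :\: I) * c (L :\: S));
  last first.
  apply: eq_bigr => S SL; rewrite wedgeE mulr_sumr mulr_suml.
  by apply: eq_bigr => I IS; rewrite exprD; ring.
rewrite (exchange_big_dep (fun I => I \subset L)) /=; last first.
  by move=> S I SL IS; exact: subset_trans IS SL.
apply: eq_bigr => I IL; rewrite wedgeE mulr_sumr.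
(* Subsets [J] of [L :\: I] correspond to the intermediate sets [S = I :|: J] between [I] and
   [L]. *)
rewrite (reindex_onto (fun S => S :\: I) (fun J => I :|: J)) /=; last first.
  move=> J; rewrite subsetD => /andP[_ dJI].
  by rewrite setDUl setDv set0U; apply/setDidPl.
apply: eq_big => [S|S /andP[sL /eqP SE]].
  apply/andP/andP => [[sL /eqP SE]|[SL IS]].
    by rewrite -SE subUset IL (subset_trans sL (subsetDl _ _)) subsetUl.
  rewrite setSD //; split=> //; apply/eqP/setP => m; rewrite !inE.
  by case mI: (m \in I) => //=; rewrite (subsetP IS).
have IS : I \subset S by rewrite -SE subsetUl.
have SL : S \subset L by rewrite -SE subUset IL (subset_trans sL (subsetDl _ _)).
have LSE : (L :\: I) :\: (S :\: I) = L :\: S by rewrite setDDl SE.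
have LIE : L :\: I = (S :\: I) :|: (L :\: S).
  apply/setP => m; rewrite !inE; case: (m \in I) / idP => [/(subsetP IS)->//|_] /=.
  by case mS: (m \in S); rewrite ?(subsetP SL _ mS).
have d1 : [disjoint S :\: I & L :\: S].
  by rewrite disjoint_sym disjoints_subset setCD subsetU // setDE subsetIr.
have d2 : [disjoint I & S :\: I] by rewrite disjoint_sym disjoints_subset setDE subsetIr.
have eS : wsign S (L :\: S) = (wsign I (L :\: S) + wsign (S :\: I) (L :\: S))%N.
  by rewrite -wsignUl // SE.
rewrite LSE eS LIE wsignUr // !exprD; ring.
Qed.

Lemma wedge0l a : wedge 0 a = 0.
Proof. by apply/ffunP => L; rewrite wedgeE ffunE big1 // => I _; rewrite ffunE mulr0 mul0r. Qed.

Lemma wedge0r a : wedge a 0 = 0.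
Proof. by apply/ffunP => L; rewrite wedgeE ffunE big1 // => I _; rewrite ffunE mulr0. Qed.

Lemma wedgeDl a b c : wedge (a + b) c = wedge a c + wedge b c.
Proof.
apply/ffunP => L; rewrite [RHS]ffunE !wedgeE -big_split; apply: eq_bigr => I _ /=.
by rewrite ffunE; ring.
Qed.

Lemma wedgeDr a b c : wedge a (b + c) = wedge a b + wedge a c.
Proof.
apply/ffunP => L; rewrite [RHS]ffunE !wedgeE -big_split; apply: eq_bigr => I _ /=.
by rewrite ffunE; ring.
Qed.

Lemma ext_scaleE (x : A) a : ext_scale x a = x *: a.
Proof. by apply/ffunP => I; rewrite !ffunE. Qed.

Lemma wedgeZl (x : A) a b : wedge (x *: a) b = x *: (wedge a b : E).
Proof.
apply/ffunP => L; rewrite [RHS]ffunE !wedgeE scaler_sumr; apply: eq_bigr => I _ /=.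
by rewrite ffunE /GRing.scale /=; ring.
Qed.

Lemma wedgeZr (x : A) a b : wedge a (x *: b) = x *: (wedge a b : E).
Proof.
apply/ffunP => L; rewrite [RHS]ffunE !wedgeE scaler_sumr; apply: eq_bigr => I _ /=.
by rewrite ffunE /GRing.scale /=; ring.
Qed.

Lemma wedge_suml (T : Type) (r : seq T) (P : pred T) (F : T -> E) b :
  wedge (\sum_(k <- r | P k) F k) b = \sum_(k <- r | P k) wedge (F k) b.
Proof. by apply: (big_morph (fun a => wedge a b)) => [x y|]; rewrite ?wedgeDl ?wedge0l. Qed.

Lemma wedge_sumr (T : Type) (r : seq T) (P : pred T) (F : T -> E) a :
  wedge a (\sum_(k <- r | P k) F k) = \sum_(k <- r | P k) wedge a (F k).
Proof. by apply: (big_morph (wedge a)) => [x y|]; rewrite ?wedgeDr ?wedge0r. Qed.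

Lemma wsign_set1r I i : wsign I [set i] = #|[set m in I | (i < m)%N]|.
Proof.
rewrite -[RHS](card_imset _ (f := fun m => (m, i))); last by move=> x y [].
apply: eq_card => -[x y]; rewrite !inE /=.
apply/andP/imsetP => [[/andP[xI /eqP->] ix]|[m]].
  by exists x; rewrite ?inE ?xI.
by rewrite inE => /andP[mI im] [-> ->]; rewrite mI eqxx.
Qed.

Lemma wsign_set1_swap I i : i \notin I -> (wsign [set i] I + wsign I [set i])%N = #|I|.
Proof.
move=> iI; rewrite wsign_set1r.
have -> : wsign [set i] I = #|[set m in I | (m < i)%N]|.
  rewrite -[RHS](card_imset _ (f := fun m => (i, m))); last by move=> x y [].
  apply: eq_card => -[x y]; rewrite !inE /=.
  apply/andP/imsetP => [[/andP[/eqP-> yI] ix]|[m]].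
    by exists y; rewrite ?inE ?yI.
  by rewrite inE => /andP[mI im] [-> ->]; rewrite mI eqxx.
rewrite -cardsUI [X in (_ + X)%N](_ : _ = 0%N) ?addn0.
  apply: eq_card => m; rewrite !inE -andb_orr; case mI: (m \in I) => //=.
  by rewrite -neq_ltn val_eqE; apply: contraTneq mI => ->.
apply/eqP; rewrite cards_eq0 -subset0; apply/subsetP => m; rewrite !inE.
by case/andP=> /andP[_ mi] /andP[_]; rewrite ltnNge (ltnW mi).
Qed.

Lemma wedge_set1r a i : wedge a (ext_basis K [set i]) = rop i a.
Proof.
apply/ffunP => L; rewrite wedgeE ffunE; case: ifPn => iL.
  rewrite (bigD1 (L :\ i)) ?subsetDl //= big1 ?addr0 => [|I /andP[IL nI]].
    rewrite ffunE setDDr setDv set0U (setIidPr _) ?sub1set // eqxx mulr1.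
    by rewrite wsign_set1r /eps; congr (_ ^+ _ * _); apply: eq_card => m; rewrite !inE;
       case: eqVneq => [->|]; rewrite ?ltnn ?andbF.
  rewrite ffunE; case: eqVneq => [LI|_]; last by rewrite mulr0.
  by case/eqP: nI; rewrite -LI setDDr setDv set0U; apply/esym/setIidPr.
rewrite big1 // => I _; rewrite ffunE; case: eqVneq => [LI|_]; last by rewrite mulr0.
by case/negP: iL; have := set11 i; rewrite -LI inE => /andP[].
Qed.

Lemma wedge_set1l a i L : wedge (ext_basis K [set i]) a L = (-1) ^+ #|L|.-1 * rop i a L.
Proof.
rewrite wedgeE ffunE; case: ifPn => iL.
  rewrite (bigD1 [set i]) ?sub1set //= big1 ?addr0 => [|I /andP[IL nI]]; last first.
    by rewrite ffunE (negbTE nI) mulr0 mul0r.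
  rewrite ffunE eqxx mulr1 mulrA; congr (_ * _).
  rewrite (cardsD1 i) iL add1n /= -(wsign_set1_swap (negbT (setD11 i L))).
  rewrite exprD -mulrA wsign_set1r -/(eps A (L :\ i) i) epsD1 // ltnn expr0 mul1r.
  by rewrite eps_sqr mulr1.
rewrite big1 ?mulr0 // => I IL; rewrite ffunE; case: eqVneq => [Ii|_]; last by rewrite mulr0 mul0r.
by case/negP: iL; rewrite -sub1set -Ii.
Qed.

(** An element of degree two commutes with everything, so left multiplication becomes right
    multiplication. The degree signs of the two moves have consecutive exponents, and the resulting
    minus sign is absorbed by [rop_rop]. *)
Lemma wedge_bivector_basis a i j :
  wedge (wedge (ext_basis K [set i]) (ext_basis K [set j])) a = rop j (rop i a).
Proof.
rewrite -wedgeA -[RHS]opprK -rop_rop; apply/ffunP => L; rewrite [RHS]ffunE wedge_set1l.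
rewrite ![rop i _ L]ffunE; case: ifP => iL; last by rewrite mulr0 oppr0.
rewrite wedge_set1l [rop j a _]ffunE; case: ifP => jL; last by rewrite !mulr0 oppr0.
rewrite (cardsD1 i L) iL add1n /= (cardsD1 j (L :\ i)) jL add1n /= exprS.
have := sqrr_sign A (odd #|L :\ i :\ j|); rewrite signr_odd => s2.
transitivity (- ((-1) ^+ #|L :\ i :\ j|) ^+ 2 *
  (eps A L i * (eps A (L :\ i) j * a (L :\ i :\ j)))); first by ring.
by rewrite s2 mulN1r.
Qed.

Lemma wedge_bivector br a :
  wedge (bivector br) a = \sum_(i < n) \sum_(j < n | (i < j)%N) br 'X_i 'X_j *: rop j (rop i a).
Proof.
rewrite /bivector wedge_suml; apply: eq_bigr => i _; rewrite wedge_suml.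
by apply: eq_bigr => j _; rewrite ext_scaleE wedgeZl wedge_bivector_basis.
Qed.

Lemma wedge1r a : wedge a (ext_one K n) = a.
Proof.
apply/ffunP => L; rewrite wedgeE (bigD1 L) //= big1 ?addr0 => [|I /andP[IL nI]].
  rewrite ffunE setDv eqxx mulr1 (_ : wsign _ _ = 0%N) ?mul1r //.
  by apply/eqP; rewrite cards_eq0 -subset0; apply/subsetP => p; rewrite !inE andbF.
rewrite ffunE setD_eq0 (_ : L \subset I = false) ?mulr0 //.
by apply: contraNF nI => LI; rewrite eqEsubset IL.
Qed.

Lemma pairing_basisl I D : pairing (ext_basis K I) D = D I.
Proof.
rewrite /pairing (bigD1 I) //= ffunE eqxx mul1r big1 ?addr0 // => J JI.
by rewrite ffunE (negbTE JI) mul0r.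
Qed.

Definition gradient (f : A) : 'rV[A]_n := \row_i mderiv i f.

Lemma jmap_one D : jmap (ext_one K n) D = D.
Proof. by apply/ffunP => I; rewrite ffunE wedge1r pairing_basisl. Qed.

Lemma rop_basis I i : rop i (ext_basis K I) =
  (if i \in I then 0 else eps A I i) *: (ext_basis K (i |: I) : E).
Proof.
apply/ffunP => L; rewrite !ffunE /GRing.scale /=.
case: ifPn => iL; last first.
  rewrite (_ : (L == i |: I) = false) ?mulr0 //.
  by apply: contraNF iL => /eqP->; rewrite setU11.
case: ifPn => iI.
  rewrite mul0r (_ : (L :\ i == I) = false) ?mulr0 //.
  by apply: contraTF iI => /eqP<-; rewrite setD11.
have -> : (L :\ i == I) = (L == i |: I) by apply/eqP/eqP => [<-|->]; rewrite ?setD1K ?setU1K.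
by case: eqVneq => [->|_]; rewrite ?mulr0 // epsU1 // ltnn mul1r.
Qed.

Lemma pairing_suml (T : Type) (r : seq T) (P : pred T) (F : T -> E) D :
  pairing (\sum_(k <- r | P k) F k) D = \sum_(k <- r | P k) pairing (F k) D.
Proof.
apply: (big_morph (fun a => pairing a D)) => [x y|].
  by rewrite /pairing -big_split; apply: eq_bigr => I _; rewrite ffunE mulrDl.
by rewrite /pairing big1 // => I _; rewrite ffunE mul0r.
Qed.

Lemma pairingZl (x : A) a D : pairing (x *: a) D = x * pairing a D.
Proof.
by rewrite /pairing mulr_sumr; apply: eq_bigr => I _; rewrite ffunE -mulrA.
Qed.

(** By associativity [df] is attached to the test form first. On a basis form this inserts one index
    with the sign [eps], which is what [cop] does on coordinates. *)
Lemma jmap_dform f a D : jmap (wedge (dform f) a) D = Cv (gradient f) (jmap a D).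
Proof.
apply/ffunP => I; rewrite ffunE wedgeA /dform wedge_sumr wedge_suml pairing_suml.
rewrite /Cv sum_ffunE; apply: eq_bigr => i _.
rewrite ext_scaleE wedgeZr wedge_set1r wedgeZl pairingZl rop_basis wedgeZl pairingZl.
by rewrite !ffunE !mxE; case: ifP => _; rewrite ?mul0r ?scaler0 ?mulr0.
Qed.

Lemma jmap_dforms l (Q : 'I_l -> A) :
  jmap (\big[@wedge K n/ext_one K n]_(k < l) dform (Q k)) (volvec K n) =
  contract (fun k => gradient (Q k)) (index_enum 'I_l) (top A n).
Proof.
elim: (index_enum _) => [|k r IH]; first by rewrite big_nil jmap_one.
by rewrite big_cons jmap_dform IH.
Qed.

End WedgeProduct.

(** * Evaluation of multivectors at a point *)

Section BaseChange.
Variables (R S : comNzRingType) (phi : {rmorphism R -> S}) (n : nat).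
Implicit Types X Y : {ffun {set 'I_n} -> R^o}.

Definition map_ext X : {ffun {set 'I_n} -> S^o} := [ffun I => phi (X I) : S^o].

Lemma map_ext0 : map_ext 0 = 0.
Proof. by apply/ffunP => I; rewrite !ffunE rmorph0. Qed.

Lemma map_extD X Y : map_ext (X + Y) = map_ext X + map_ext Y.
Proof. by apply/ffunP => I; rewrite !ffunE rmorphD. Qed.

Lemma map_extZ a X : map_ext (a *: X) = phi a *: map_ext X.
Proof. by apply/ffunP => I; rewrite !ffunE rmorphM. Qed.

Lemma map_ext_sum (T : Type) (r : seq T) (P : pred T) (F : T -> {ffun {set 'I_n} -> R^o}) :
  map_ext (\sum_(k <- r | P k) F k) = \sum_(k <- r | P k) map_ext (F k).
Proof. exact: (big_morph map_ext map_extD map_ext0). Qed.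

Lemma map_ext_rop i X : map_ext (rop i X) = rop i (map_ext X).
Proof.
by apply/ffunP => I; rewrite !ffunE; case: ifP; rewrite ?rmorph0 // rmorphM /eps rmorph_sign.
Qed.

Lemma map_ext_cop i X : map_ext (cop i X) = cop i (map_ext X).
Proof.
by apply/ffunP => I; rewrite !ffunE; case: ifP; rewrite ?rmorph0 // rmorphM /eps rmorph_sign.
Qed.

Lemma map_ext_Rv u X : map_ext (Rv u X) = Rv (map_mx phi u) (map_ext X).
Proof.
by rewrite map_ext_sum; apply: eq_bigr => i _; rewrite map_extZ map_ext_rop mxE.
Qed.

Lemma map_ext_Cv g X : map_ext (Cv g X) = Cv (map_mx phi g) (map_ext X).
Proof.
by rewrite map_ext_sum; apply: eq_bigr => i _; rewrite map_extZ map_ext_cop mxE.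
Qed.

Lemma map_ext_W2 M X : map_ext (W2 M X) = W2 (map_mx phi M) (map_ext X).
Proof.
rewrite map_ext_sum; apply: eq_bigr => i _; rewrite map_ext_Rv map_ext_rop.
by rewrite map_row.
Qed.

Lemma map_ext_vac : map_ext (vac R n) = vac S n.
Proof. by apply/ffunP => I; rewrite !ffunE rmorph_nat. Qed.

Lemma map_ext_top : map_ext (top R n) = top S n.
Proof. by apply/ffunP => I; rewrite !ffunE rmorph_nat. Qed.

Lemma map_ext_iter_W2 M k :
  map_ext (iter k (W2 M) (vac R n)) = iter k (W2 (map_mx phi M)) (vac S n).
Proof. by elim: k => [|k IH]; rewrite ?map_ext_vac // !iterS map_ext_W2 IH. Qed.

Lemma map_ext_contract (L : eqType) (g : L -> 'rV[R]_n) r :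
  map_ext (contract g r (top R n)) = contract (fun a => map_mx phi (g a)) r (top S n).
Proof. by elim: r => [|a r IH]; rewrite /= ?map_ext_top // map_ext_Cv IH. Qed.

End BaseChange.

Lemma rop_rop0 (R : comNzRingType) n (i : 'I_n) (X : {ffun {set 'I_n} -> R^o}) :
  rop i (rop i X) = 0.
Proof. by apply/ffunP => I; rewrite !ffunE setD11; case: ifP; rewrite ?mulr0. Qed.

(** The pairs [(i, j)] and [(j, i)] contribute equally, as the matrix entry and the product of
    operators both change sign; diagonal terms vanish. *)
Lemma W2_double (R : comNzRingType) n (M : 'M[R]_n) (X : {ffun {set 'I_n} -> R^o}) :
  M^T = - M ->
  W2 M X = 2%:R *: \sum_(i < n) \sum_(j < n | (i < j)%N) M i j *: rop j (rop i X).
Proof.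
move=> Manti; pose t i j : {ffun {set 'I_n} -> R^o} := M i j *: rop j (rop i X).
have tC i j : t i j = t j i.
  by have /matrixP/(_ i j) := Manti; rewrite /t !mxE => ->; rewrite rop_rop scaleNr scalerN.
transitivity (\sum_(i < n) (\sum_(j < n | (i < j)%N) t i j + \sum_(j < n | (j < i)%N) t i j)).
  apply: eq_bigr => i _; rewrite /Rv (bigID (fun j : 'I_n => (i < j)%N)) /=; congr (_ + _).
    by apply: eq_bigr => j _; rewrite mxE.
  rewrite (bigD1 i) ?ltnn //= rop_rop0 scaler0 add0r; apply: eq_big => [j|j _]; last by rewrite mxE.
  by rewrite -leqNgt ltn_neqAle andbC.
rewrite big_split /= [X in _ + X](exchange_big_dep xpredT) //= scaler_nat mulr2n.
by congr (_ + _); apply: eq_bigr => i _; apply: eq_bigr => j _; exact: tC.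
Qed.

(** * The Poisson bracket and its matrix *)

Section PoissonBivector.
Variables (K : fieldType) (n : nat) (br : {mpoly K[n]} -> {mpoly K[n]} -> {mpoly K[n]}).
Hypothesis brP : is_poisson_bracket br.
Local Notation A := {mpoly K[n]}.

(** The bracket is a derivation in its first argument, hence determined by the variables. For
    central [f] this puts the gradient in the left kernel of the bracket matrix. *)
Lemma br_chain f g : br f g = \sum_i mderiv i f * br 'X_i g.
Proof.
case: brP => brL brN brM _.
have br0 h : br 0 h = 0.
  by have := brL (-1) 0 0 h; rewrite scaler0 add0r scaleN1r addNr.
have brMl f1 f2 h : br (f1 * f2) h = br f1 h * f2 + f1 * br f2 h.
  by rewrite brN brM opprD (brN h f1) (brN h f2) mulrN mulNr !opprK addrC; ring.
pose good f1 := br f1 g = \sum_i mderiv i f1 * br 'X_i g.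
have goodM f1 f2 : good f1 -> good f2 -> good (f1 * f2).
  rewrite /good brMl => -> ->; rewrite mulr_suml mulr_sumr -big_split.
  by apply: eq_bigr => i _ /=; rewrite mderivM; ring.
have good1 : good 1.
  have b1 : br 1 g = 0.
    have := brMl 1 1 g; rewrite !mulr1 !mul1r => /eqP.
    by rewrite eq_sym -subr_eq0 addrK => /eqP.
  by rewrite /good b1 big1 // => i _; rewrite -mpolyC1 mderivC mul0r.
have goodX i : good 'X_i.
  rewrite /good (bigD1 i) //= mderivX mnm1E eqxx big1 ?addr0 => [|j ji].
    by rewrite (_ : (U_(i) - U_(i))%MM = 0%MM) ?mpolyX0 ?scale1r ?mul1r //; apply/mnmP => k;
       rewrite mnmBE subnn mnm0E.
  by rewrite mderivX mnm1E eq_sym (negbTE ji) scale0r mul0r.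
rewrite -/(good f); elim/mpolyind: f => [|c m p _ _ IH].
  by rewrite /good br0 big1 // => i _; rewrite mderiv0 mul0r.
rewrite /good brL IH.
have -> : br 'X_[m] g = \sum_i mderiv i 'X_[m] * br 'X_i g.
  rewrite -/(good 'X_[m]) mpolyXE_id; apply: (big_ind good) => // i _.
  by elim: (m i) => [|k IHk]; rewrite ?expr0 // exprS; apply: goodM.
rewrite scaler_sumr -big_split; apply: eq_bigr => i _ /=.
by rewrite mderivD mderivZ mulrDl scalerAl.
Qed.

Definition bracket_mx : 'M[A]_n := \matrix_(i, j) br 'X_i 'X_j.

Lemma bracket_mx_anti : bracket_mx^T = - bracket_mx.
Proof. by case: brP => _ brN _ _; apply/matrixP => i j; rewrite !mxE. Qed.

Lemma map_bracket_mx xi : map_mx (meval xi) bracket_mx = pimx br xi.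
Proof. by apply/matrixP => i j; rewrite !mxE. Qed.

Lemma pimx_anti xi : (pimx br xi)^T = - pimx br xi.
Proof.
by case: brP => _ brN _ _; apply/matrixP => i j; rewrite !mxE brN mevalN.
Qed.

Lemma iter_W2_bivector k :
  iter k (W2 bracket_mx) (vac A n) = (2%:R ^+ k : A) *:
    (wpow (bivector br) k : {ffun {set 'I_n} -> A^o}).
Proof.
elim: k => [|k IH]; first by rewrite expr0 scale1r.
rewrite iterS IH linearZ /= (W2_double _ bracket_mx_anti) scalerA -exprSr; congr (_ *: _).
rewrite [RHS]wedge_bivector; apply: eq_bigr => i _; apply: eq_bigr => j _.
by rewrite mxE.
Qed.

Lemma eval_wpow xi k : iter k (W2 (pimx br xi)) (vac K n) =
  (2%:R ^+ k : K) *: map_ext (meval xi) (wpow (bivector br) k).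
Proof.
by rewrite -map_bracket_mx -map_ext_iter_W2 iter_W2_bivector map_extZ rmorphXn rmorph_nat.
Qed.

End PoissonBivector.

(** * Proof of the theorem *)

Lemma codim_ge2_prime_locus (K : closedFieldType) n (S : ('I_n -> K) -> Prop)
    (q : {mpoly K[n]}) :
  codim_ge2 S -> prime_elt q -> ~ subs (zero_locus q) S.
Proof.
case: n => [|n] in S q *; move=> cS [q0 nUq _] qS.
  case/negP: nUq; rewrite (nvar0_mpolyC q) rmorph_unit // unitfE.
  by apply: contraNneq q0 => q00; rewrite (nvar0_mpolyC q) q00.
exact: codim_ge2_no_chain qS (hypersurface_chain q0 nUq) cS.
Qed.

(** Otherwise [S] would contain the hyperplane ['X_ord0 = 0]. *)
Lemma codim_ge2_proper (K : closedFieldType) n (S : ('I_n -> K) -> Prop) :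
  (0 < n)%N -> codim_ge2 S -> exists x, ~ S x.
Proof.
case: n S => // n S _ cS; apply: not_all_ex_not => Sall.
have sX : subs (zero_locus ('X_ord0 : {mpoly K[n.+1]})) S by move=> x _.
exact: codim_ge2_no_chain sX (hypersurface_chain (mpolyX_neq0 _ _) (mpolyX_nonunit _ _)) cS.
Qed.

Lemma proportional_divides (R : idomainType) (T : Type) (P r : T -> R) b a us :
  factorization b us -> (forall t, b * P t = a * r t) ->
  (forall q, prime_elt q -> ~ forall t, divides q (r t)) ->
  exists a', forall t, P t = a' * r t.
Proof.
case: us => u s [/= Uu sP ->] + rprim.
elim: s sP a => [|q s IH] sP a baE.
  by exists (u^-1 * a) => t; rewrite -mulrA -baE big_nil mulr1 mulKr.
have qP : prime_elt q by apply: sP; rewrite mem_head.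
have [q0 _ qM] := qP.
have qa t : divides q (a * r t).
  by rewrite -baE big_cons -mulrA mulrCA; apply/dividesMr/dividesMr/dividesxx.
have [c aE] : divides q a.
  by apply: NNPP => nqa; case: (rprim q qP) => t; case: (qM _ _ (qa t)).
apply: (IH (fun p ps => sP p (mem_behead (s := q :: s) ps)) c) => t.
apply: (mulfI q0); have := baE t; rewrite big_cons aE => e.
by rewrite [RHS]mulrA [q * c]mulrC -e; ring.
Qed.

Section Admissible.
Variables (K : closedFieldType) (n : nat).
Variables (br : {mpoly K[n]} -> {mpoly K[n]} -> {mpoly K[n]}) (l : nat).
Variable Q : 'I_l -> {mpoly K[n]}.
Hypotheses (K0 : [pchar K] =i pred0) (brP : is_poisson_bracket br).
Hypotheses (indl : is_index br l) (Qcentral : forall k, in_poisson_centre br (Q k)).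
Hypothesis codimJ : codim_ge2 (jacobian_locus Q).
Local Notation A := {mpoly K[n]}.
Local Notation E := {ffun {set 'I_n} -> A^o}.

Let P : E := wpow (bivector br) (n - l)./2.
Let r : E := jmap (\big[@wedge K n/ext_one K n]_(k < l) dform (Q k)) (volvec K n).
Let G (xi : 'I_n -> K) : 'M[K]_(l, n) := \matrix_(k < l, i < n) (mderiv i (Q k)).@[xi].

Let pow2_neq0 k : (2%:R ^+ k : K) != 0.
Proof. by rewrite expf_neq0 //; move/pcharf0P: K0 => ->. Qed.

Lemma even_corank : (n - l)./2.*2 = (n - l)%N.
Proof.
have [_ [[xi <-] _]] := indl.
by rewrite /rk_pi; have [k -> _] := antisym_rank K0 (pimx_anti brP xi); rewrite doubleK.
Qed.

Lemma rank_power_neq0 xi : rk_pi br xi = (n - l)%N -> exists I, (P I).@[xi] != 0.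
Proof.
move=> rkxi; have [k rk0 kP] := antisym_rank K0 (pimx_anti brP xi).
have kE : k = (n - l)./2 by rewrite -rkxi /rk_pi rk0 doubleK.
rewrite kE (eval_wpow brP) scaler_eq0 (negbTE (pow2_neq0 _)) in kP.
apply: NNPP => /not_ex_all_not PI0; case/eqP: kP; apply/ffunP => I; rewrite !ffunE.
by apply/eqP; apply: contraT => /PI0.
Qed.

Let gradE k xi : map_mx (meval xi) (gradient (Q k)) = row k (G xi).
Proof. by apply/rowP => i; rewrite !mxE. Qed.

Let evalr xi : map_ext (meval xi) r =
  contract (fun k => row k (G xi)) (index_enum 'I_l) (top K n).
Proof.
rewrite /r jmap_dforms map_ext_contract; elim: (index_enum _) => //= k s ->.
by rewrite gradE.
Qed.

(** The dual vectors are the columns of a right inverse of the Jacobian matrix. *)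
Let dual xi : row_free (G xi) -> exists u : 'I_l -> 'rV[K]_n,
  forall a b, dot (row a (G xi)) (u b) = (a == b)%:R.
Proof.
case/row_freeP=> U GU; exists (fun b => (col b U)^T) => a b.
have /matrixP/(_ a b) := GU; rewrite !mxE => <-.
by apply: eq_bigr => i _; rewrite !mxE.
Qed.

Lemma independent_jmap_neq0 xi : row_free (G xi) -> exists I, (r I).@[xi] != 0.
Proof.
case/dual=> u Gu; have := contract_top_neq0 Gu (index_enum_uniq 'I_l).
rewrite -evalr => /eqP r0; apply: NNPP => /not_ex_all_not rI0; apply: r0.
by apply/ffunP => I; rewrite [LHS]ffunE [RHS]ffunE; apply/eqP/negPn/negP/rI0.
Qed.

Let Gpi xi : G xi *m pimx br xi = 0.
Proof.
apply/matrixP => k j; rewrite !mxE -[RHS](meval0 xi) -(Qcentral k 'X_j) (br_chain brP).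
by rewrite raddf_sum; apply: eq_bigr => i _ /=; rewrite !mxE mevalM.
Qed.

Lemma independent_proportional xi : row_free (G xi) ->
  exists c, forall I, (P I).@[xi] = c * (r I).@[xi].
Proof.
case/dual=> u Gu; set k := (n - l)./2.
have kill a j : Cv (row a (G xi)) (iter j (W2 (pimx br xi)) (vac K n)) = 0.
  elim: j => [|j IH]; first exact: Cv_vac.
  rewrite iterS Cv_W2 ?IH ?linear0 //; first exact: pimx_anti.
  by rewrite -row_mul Gpi row0.
(* The number of [Q_k] equals the index, so wedging the power with all [l] dual vectors lands
   exactly in top degree. *)
have deg : (k.*2 + size (index_enum 'I_l))%N = n.
  by rewrite even_corank -sum1_size sum1_card card_ord subnK //; case: indl.
have [c cE] := killed_multiple_contract Gu (index_enum_uniq 'I_l)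
    (@hom_iter_W2 K n k (pimx br xi)) deg (fun a _ => kill a k).
(* The factor compensates for [W2] being twice the bivector. *)
exists ((2%:R ^+ k)^-1 * c) => I.
have /ffunP/(_ I) := cE; rewrite (eval_wpow brP) -evalr !ffunE /GRing.scale /= -/k => e.
by rewrite -mulrA -e mulKf.
Qed.

Lemma independent_point : exists xi, row_free (G xi).
Proof.
(* For [n = 0] also [l = 0], and the empty Jacobian matrix is row-free. *)
have [n0|npos] := posnP n.
  have l0 : l = 0%N by case: indl => ln _; lia.
  by exists (fun=> 0); apply/eqP; have := rank_leq_row (G (fun=> 0)); lia.
by have [x Jx] := codim_ge2_proper npos codimJ; exists x; apply/negPn/negP.
Qed.

Lemma power_proportional I J : P I * r J = P J * r I.
Proof.
have [xi0 /row_freeP[U GU]] := independent_point.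
(* Using the constant right inverse at [xi0] makes [D] equal to [1] there without selecting a minor.
   Wherever [D] is nonzero the gradients are independent, so the difference times [D] vanishes at
   every point. *)
pose D := \det ((\matrix_(k < l, i < n) mderiv i (Q k)) *m map_mx (@mpolyC n K) U).
have DE xi : D.@[xi] = \det (G xi *m U).
  rewrite -det_map_mx map_mxM; congr (\det (_ *m _)).
    by apply/matrixP => k i; rewrite !mxE.
  by apply/matrixP => k i; rewrite !mxE; exact: mevalC.
have D0 : D != 0.
  by apply/eqP => /(congr1 (meval xi0)); rewrite DE GU det1 meval0 => /eqP; rewrite oner_eq0.
apply/eqP; rewrite -subr_eq0; suff : (P I * r J - P J * r I) * D == 0.
  by rewrite mulf_eq0 (negbTE D0) orbF.
apply/eqP/mpoly_vanishing => xi; rewrite mevalM mevalB !mevalM DE.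
have [->|GU0] := eqVneq (\det (G xi *m U)) 0; first by rewrite mulr0.
have /independent_proportional[c PE] : row_free (G xi).
  apply/row_freeP; exists (U *m invmx (G xi *m U)).
  by rewrite mulmxA mulmxV // unitmxE unitfE.
by rewrite !PE; ring.
Qed.

Lemma power_eq_scaled_jmap : codim_ge2 (Sing_pi br l) ->
  exists2 lambda : K, lambda != 0 & forall I, P I = lambda%:MP * r I.
Proof.
move=> codimS; have [xi0 /independent_jmap_neq0[I0 rI0]] := independent_point.
have rI0' : r I0 != 0 by apply: contraNneq rI0 => ->; rewrite meval0.
have [us us_r] := factorial_mpoly rI0'.
have [||a PE] := @proportional_divides _ _ P r _ (P I0) _ us_r.
- by move=> I; rewrite mulrC power_proportional.
- move=> q qP qr; apply: (codim_ge2_prime_locus codimJ qP) => xi qxi.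
  apply/negP => /independent_jmap_neq0[I]; have [c ->] := qr I.
  by rewrite mevalM qxi mulr0 eqxx.
have [_ [[xi1 /rank_power_neq0[I1 PI1]] rkmax]] := indl.
have a0 : a != 0 by apply: contraNneq PI1 => a0; rewrite PE a0 mul0r meval0.
have aU : a \is a GRing.unit.
  apply: contraT => nUa.
  have [q qP qa] := mpoly_prime_divisor a0 nUa.
  case: (codim_ge2_prime_locus codimS qP) => xi /qa axi.
  rewrite /Sing_pi ltn_neqAle rkmax andbT; apply/negP => /eqP/rank_power_neq0[I].
  by rewrite PE mevalM axi mul0r eqxx.
(* A unit of the polynomial ring is constant, equal to its constant coefficient. *)
exists a@_0%MM => [|I]; last by rewrite -mpoly_unit_constant // PE.
by apply: contraNneq a0; rewrite {2}(mpoly_unit_constant aU) => ->.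
Qed.

End Admissible.

Theorem theorem1p3 (K : closedFieldType) (n : nat)
  (br : {mpoly K[n]} -> {mpoly K[n]} -> {mpoly K[n]})
  (l : nat) (Q : 'I_l -> {mpoly K[n]}) :
  [pchar K] =i pred0 ->
  is_poisson_bracket br ->
  quasi_regular br ->
  is_index br l ->
  admissible br Q ->
  exists2 lambda : K, lambda != 0 &
    wpow (bivector br) (n - l)./2 =
    ext_scale (lambda%:MP)
      (jmap (\big[@wedge K n/ext_one K n]_(k < l) dform (Q k)) (volvec K n)).
Proof.
move=> K0 brP [l' [indl' [_ codimS]]] indl [Qcentral _ codimJ].
(* Both numbers are [n] minus the maximal rank, so the codimension bound on the singular locus holds
   for the given [l]. *)
have l'l : l' = l.
  have [l'n [[x' rx'] max']] := indl'; have [ln [[x rx] max]] := indl.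
  have := max' x; have := max x'; rewrite rx rx'; lia.
rewrite l'l in codimS.
have [lambda lambda0 PE] := power_eq_scaled_jmap K0 brP indl Qcentral codimJ codimS.
by exists lambda => //; apply/ffunP => I; rewrite PE [RHS]ffunE.
Qed.
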